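(* Let $(\beta,\gamma,\lambda)$ be anti-ferromagnetic and let $\Delta\ge 2$ be an integer or $\Delta=\infty$. The two-state spin system with parameters $(\beta,\gamma,\lambda)$ has strong spatial mixing on the family of all finite graphs of maximum degree at most $\Delta$ (for $\Delta=\infty$: on the family of all finite graphs) if and only if $(\beta,\gamma,\lambda)$ is $\Delta$-unique, i.e. the system exhibits uniqueness on the infinite $d$-regular trees for all $d\le\Delta$.
   Context: A two-state spin system with parameters $\beta,\gamma\ge 0$, $\lambda>0$ on a finite graph $G=(V,E)$: each configuration $\sigma:V\to\{0,1\}$ (spin $0$ = ''blue'', spin $1$ = ''green'') has weight $w(\sigma)=\prod_{(u,v)\in E}A_{\sigma(u),\sigma(v)}\prod_{v\in V}b_{\sigma(v)}$, where $A_{0,0}=\beta$, $A_{0,1}=A_{1,0}=1$, $A_{1,1}=\gamma$, $b_0=\lambda$, $b_1=1$. The partition function is $Z(G)=\sum_\sigma w(\sigma)$ and the Gibbs measure is $\rho(\sigma)=w(\sigma)/Z(G)$. The parameters $(\beta,\gamma,\lambda)$ are anti-ferromagnetic if $0\le\beta\le\gamma$, $\gamma>0$, $\beta\gamma<1$ and $\lambda>0$. For an integer $d\ge1$ let $f_d(x)=\lambda\left(\frac{\beta x+1}{x+\gamma}\right)^d$ and let $\hat x_d$ be its unique positive fixed point. For $\Delta\in\{2,3,\dots\}\cup\{\infty\}$, $(\beta,\gamma,\lambda)$ is called $\Delta$-unique if for every integer $1\le d<\Delta$, $|f_d'(\hat x_d)|=\frac{d(1-\beta\gamma)\hat x_d}{(\beta\hat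 x_d+1)(\hat x_d+\gamma)}<1$. (The condition for $d$ corresponds to uniqueness of the Gibbs measure on the infinite $(d+1)$-regular tree.) For $\Lambda\subseteq V$ and $\sigma_\Lambda\in\{0,1\}^\Lambda$, $p_v^{\sigma_\Lambda}$ denotes the probability under the Gibbs measure that vertex $v$ has spin $0$, conditioned on the configuration restricted to $\Lambda$ being $\sigma_\Lambda$. The system has strong spatial mixing on a family of graphs if there are constants $C,c>0$ such that for every graph $G=(V,E)$ in the family, every $v\in V$, $\Lambda\subseteq V$ and $\sigma_\Lambda,\tau_\Lambda\in\{0,1\}^\Lambda$, $|p_v^{\sigma_\Lambda}-p_v^{\tau_\Lambda}|\le C\exp(-c\,\mathrm{dist}_G(v,S))$, where $S\subseteq\Lambda$ is the set of vertices on which $\sigma_\Lambda$ and $\tau_\Lambda$ differ and $\mathrm{dist}_G(v,S)$ is the shortest-path distance from $v$ to $S$. *)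

(* Defs.v *)
From HB Require Import structures.
From mathcomp Require Import all_boot all_order all_algebra.
From mathcomp Require Import all_classical all_reals all_analysis.
From mathcomp Require Import ring lra.

Set Implicit Arguments.
Unset Strict Implicit.
Unset Printing Implicit Defensive.

Import Order.TTheory GRing.Theory Num.Theory.
Import numFieldNormedType.Exports.

Local Open Scope classical_set_scope.
Local Open Scope ring_scope.

Record sgraph := SGraph {
  vertex :> finType;
  adj : rel vertex;
  adj_sym : symmetric adj;
  adj_irrefl : irreflexive adj
}.

(* Degree bounds range over nat plus infinity; None stands for infinity. *)
Definition deg_lt (d : nat) (Delta : option nat) : bool :=
  if Delta is Some D then (d < D)%N else true.

Definition deg_le (d : nat) (Delta : option nat) : bool :=
  if Delta is Some D then (d <= D)%N else true.

Definition max_degree_le (Delta : option nat) (G : sgraph) : Prop :=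
  forall v : G, deg_le #|adj v| Delta.

(* Shortest-path distance from v to a set; it is +oo when the set is empty or
   unreachable from v. *)
Definition dist (R : realType) (G : sgraph) (v : G) (S : {set G}) : \bar R :=
  ereal_inf [set ((size p)%:R)%:E | p in
    [set p : seq G | path (@adj G) v p /\ last v p \in S]].

(* Spins are booleans: false is spin 0 (blue), true is spin 1 (green). *)
Definition config (G : sgraph) := {ffun G -> bool}.

Section SpinSystem.
Variables (R : realType) (beta gamma lambda : R).

Definition antiferromagnetic : Prop :=
  [/\ 0 <= beta, beta <= gamma, 0 < gamma, beta * gamma < 1 & 0 < lambda].

Definition edge_weight (a b : bool) : R :=
  match a, b with
  | false, false => beta
  | true, true => gamma
  | _, _ => 1
  end.

Definition vertex_weight (a : bool) : R := if a then 1 else lambda.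

(* Ordering the endpoints by enum_rank makes each undirected edge contribute
   exactly one factor. *)
Definition weight (G : sgraph) (s : config G) : R :=
  (\prod_(e : G * G | adj e.1 e.2 && (enum_rank e.1 < enum_rank e.2)%N)
     edge_weight (s e.1) (s e.2)) *
  \prod_(v : G) vertex_weight (s v).

Definition partition_function (G : sgraph) : R :=
  \sum_(s : config G) weight s.

Definition gibbs (G : sgraph) (s : config G) : R :=
  weight s / partition_function G.

Definition gibbs_prob (G : sgraph) (A : pred (config G)) : R :=
  \sum_(s : config G | A s) gibbs s.

(* A partial configuration on L is given by any total configuration extending
   it; only its values on L are ever used. *)
Definition agree_on (G : sgraph) (L : {set G}) (sL s : config G) : bool :=
  [forall u in L, s u == sL u].

(* When beta = 0 the conditioning event may be null, in which case the
   conditional probability is undefined; see [feasible]. *)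
Definition marginal (G : sgraph) (v : G) (L : {set G}) (sL : config G) : R :=
  gibbs_prob [pred s : config G | (s v == false) && agree_on L sL s] /
  gibbs_prob (agree_on L sL).

Definition feasible (G : sgraph) (L : {set G}) (sL : config G) : Prop :=
  0 < gibbs_prob (agree_on L sL).

Definition disagreement (G : sgraph) (L : {set G}) (sL tL : config G) :
    {set G} :=
  [set u in L | sL u != tL u]%SET.

(* At infinite distance the bound is C * expeR -oo = 0. *)
Definition strong_spatial_mixing (family : sgraph -> Prop) : Prop :=
  exists C c : R, [/\ 0 < C, 0 < c &
    forall G : sgraph, family G ->
    forall (v : G) (L : {set G}) (sL tL : config G),
      feasible L sL -> feasible L tL ->
      (`|marginal v L sL - marginal v L tL|%:E
        <= C%:E * expeR (- (c%:E * dist R v (disagreement L sL tL))))%E].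

Definition tree_map (d : nat) (x : R) : R :=
  lambda * ((beta * x + 1) / (x + gamma)) ^+ d.

(* The default value 0 is never used, by [tree_fixpointP]. *)
Definition tree_fixpoint (d : nat) : R :=
  xget 0 [set x | 0 < x /\ tree_map d x = x].

Definition Delta_unique (Delta : option nat) : Prop :=
  forall d : nat, (1 <= d)%N -> deg_lt d Delta ->
    `|derive1 (tree_map d) (tree_fixpoint d)| < 1.

Lemma is_derive_tree_map d (x : R) : x + gamma != 0 ->
  is_derive x 1 (tree_map d)
    (lambda * (((beta * x + 1) / (x + gamma)) ^+ d.-1 *+ d *
       ((beta * gamma - 1) / (x + gamma) ^+ 2))).
Proof.
move=> xg0.
have h1 : is_derive x 1 (fun y : R => beta * y + 1) beta.
  by apply: is_derive_eq; rewrite !(scaler0, addr0, add0r) /GRing.scale /= mulr1.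
have h2 : is_derive x 1 (fun y : R => y + gamma) 1.
  by apply: is_derive_eq; rewrite addr0.
have h3 : is_derive x 1 (fun y : R => (y + gamma)^-1) (- (x + gamma) ^- 2).
  by apply: is_derive_eq; rewrite /GRing.scale /= mulr1.
have h4 : is_derive x 1 (fun y : R => (beta * y + 1) / (y + gamma))
    ((beta * gamma - 1) / (x + gamma) ^+ 2).
  apply: is_derive_eq; rewrite /GRing.scale /=.
  by field.
have h5 := @is_deriveZ _ _ _ _ lambda _ _ _ (is_deriveX d h4).
have -> : tree_map d =
    lambda \*: (fun y : R => (beta * y + 1) / (y + gamma)) ^+ d.
  by apply/funext => y; rewrite /tree_map exprfctE.
by apply: is_derive_eq; rewrite /GRing.scale /= -mulr_natl; ring.
Qed.

Lemma tree_map_le d (x y : R) : antiferromagnetic ->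
  0 <= x -> x <= y -> tree_map d y <= tree_map d x.
Proof.
case=> b0 bg g0 bg1 l0 x0 xy; rewrite /tree_map ler_pM2l //.
have y0 : 0 <= y by exact: le_trans xy.
have xg : 0 < x + gamma by exact: ltr_wpDl.
have yg : 0 < y + gamma by exact: ltr_wpDl.
have p0 z : 0 <= z -> 0 <= (beta * z + 1) / (z + gamma).
  by move=> z0; rewrite divr_ge0 ?addr_ge0 ?mulr_ge0 // ltW.
apply: lerXn2r; [exact: p0|exact: p0|].
rewrite ler_pdivrMr // mulrAC ler_pdivlMr //; nra.
Qed.

Lemma tree_fixpointP d : antiferromagnetic ->
  (0 < tree_fixpoint d /\ tree_map d (tree_fixpoint d) = tree_fixpoint d) /\
  forall x, 0 < x -> tree_map d x = x -> x = tree_fixpoint d.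
Proof.
move=> af; have [b0 bg g0 bg1 l0] := af.
set P := [set x | 0 < x /\ tree_map d x = x].
have f0 : 0 < tree_map d 0.
  by rewrite /tree_map mulr0 !add0r mulr_gt0 // exprn_gt0 // divr_gt0.
have exP : exists x, P x.
  pose g (x : R) := tree_map d x - x.
  have cg : {within `[0, tree_map d 0], continuous g}.
    apply: continuous_in_subspaceT => x; rewrite inE/= in_itv/= => /andP[x0 _].
    apply: cvgB; last exact: cvg_id.
    have xg : x + gamma != 0 by rewrite gt_eqF// ltr_wpDl.
    have := is_derive_tree_map d xg; case=> /derivable1_diffP h _.
    exact: differentiable_continuous h.
  have g0E : 0 <= g 0 by rewrite /g subr0 ltW.
  have g1E : g (tree_map d 0) <= 0 by rewrite /g subr_le0 tree_map_le// ltW.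
  have [||c] := @IVT R g 0 (tree_map d 0) 0 _ cg; first exact: ltW.
    by rewrite ge_min g1E orbT le_max g0E.
  rewrite in_itv/= => /andP[c0 _] /eqP; rewrite /g subr_eq0 => /eqP fc.
  exists c; split=> //; rewrite lt_neqAle c0 andbT.
  by apply: contraTneq f0 => c0'; rewrite c0' fc -c0' ltxx.
have Pfix : P (tree_fixpoint d) by exact: xgetPex.
split=> // x x0 fx; have [y0 fy] := Pfix.
have [xy|yx|//] := ltgtP x (tree_fixpoint d).
  have := tree_map_le d af (ltW x0) (ltW xy); rewrite fx fy; lra.
have := tree_map_le d af (ltW y0) (ltW yx); rewrite fx fy; lra.
Qed.

Lemma tree_map_derivE d : antiferromagnetic -> (1 <= d)%N ->
  let x := tree_fixpoint d in
  `|derive1 (tree_map d) x| =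
  d%:R * (1 - beta * gamma) * x / ((beta * x + 1) * (x + gamma)).
Proof.
move=> af; have [b0 bg g0 bg1 l0] := af.
case: d => // d _ x.
have [[x0 fx] _] := tree_fixpointP d.+1 af; rewrite -/x in x0 fx.
have xg : 0 < x + gamma by rewrite addr_gt0.
have bx : 0 < beta * x + 1 by rewrite ltr_wpDl// mulr_ge0// ltW.
rewrite derive1E (derive_val (is_derive := is_derive_tree_map d.+1 (lt0r_neq0 xg))).
rewrite /= -[in RHS]mulrA -[X in _ = _ * (X / _)]fx /tree_map.
set q := _ / (x + gamma); have q0 : 0 < q by rewrite divr_gt0.
rewrite ler0_norm; last first.
  rewrite pmulr_rle0// pmulr_rle0 ?pmulrn_lgt0 ?exprn_gt0//.
  by rewrite pmulr_lle0 ?invr_gt0 ?exprn_gt0// subr_le0 ltW.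
rewrite [q ^+ d.+1]exprS -[_ *+ d.+1]mulr_natl; set Q := q ^+ d; rewrite /q.
field.
by rewrite !lt0r_neq0.
Qed.

End SpinSystem.

(* Main.v *)
Require Import Defs.
From HB Require Import structures.
From mathcomp Require Import all_boot all_order all_algebra.
From mathcomp Require Import all_classical all_reals all_analysis.
From mathcomp Require Import ring lra zify.

(* Uniqueness implies mixing.  Removing a vertex [v] and telescoping over its
   neighbours expresses the ratio [x = P(v = 0) / P(v = 1)] as
   [lambda * prod_i F(x_i)] with [F x = (beta x + 1) / (x + gamma)], where [x_i]
   is the ratio at a neighbour in the graph without [v] and frozen neighbours
   count as [x_i = 0] or [x_i = +oo] (Weitz).  Two boundary conditions are joined
   by curves of ratios, and in the metric
   [|dx| / sqrt (x (beta x + 1) (x + gamma))] one step of the recursion with [d]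
   children multiplies the squared speed by at most [s * exp (s - 1)], where
   [s = |f_d'(xhat_d)|].  This comes from Cauchy-Schwarz and from
   [exp t >= 1 + t] applied at the fixed point in logarithmic coordinates, where
   the first order terms cancel.  If [Delta] is infinite, uniqueness forces
   [gamma > 1], so that [s] tends to [0] as [d] grows and the rates are bounded
   away from [1].

   Mixing implies uniqueness.  On the [d]-ary tree of depth [m + 1] the root
   ratios for the two constant leaf boundaries are the [m]-th iterates of [f_d]
   at [lambda beta^d] and [lambda gamma^-d].  They enclose [xhat_d], so mixing
   makes the iterates converge to [xhat_d] exponentially fast, which is
   impossible when [|f_d'(xhat_d)| >= 1]. *)

Set Implicit Arguments.
Unset Strict Implicit.
Unset Printing Implicit Defensive.

Import Order.TTheory GRing.Theory Num.Theory.
Import numFieldNormedType.Exports.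

Local Open Scope ring_scope.

(** * Elementary inequalities *)

Lemma mul_expRN_le (R : realType) (s r : R) : 0 <= s ->
  s * expR (- r) * (s + r) <= s * expR (s - 1).
Proof.
move=> s0; rewrite -mulrA ler_wpM2l//.
have -> : s - 1 = - r + (s + r - 1) by ring.
rewrite expRD ler_wpM2l ?expR_ge0//.
by have := expR_ge1Dx (s + r - 1); lra.
Qed.

(** Cauchy-Schwarz against a constant vector; the inductive step reduces to the square of
    [m * a u - S]. *)
Lemma sum_sqr_le (R : realType) (I : Type) (us : seq I) (a : I -> R) :
  (\sum_(u <- us) a u) ^+ 2 <= (size us)%:R * \sum_(u <- us) a u ^+ 2.
Proof.
elim: us => [|u us IH]; first by rewrite !big_nil mul0r expr0n.
rewrite !big_cons /= -natr1; move: IH.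
case: us => [|u' us].
  by rewrite !big_nil /=; nra.
set us' := u' :: us; set S := \sum_(_ <- us') _; set Q := \sum_(_ <- us') _.
have : 0 < (size us')%:R :> R by rewrite ltr0n.
move: (size us')%:R => m m0 H.
rewrite -(ler_pM2l m0).
have := sqr_ge0 (m * a u - S); nra.
Qed.

(** The right side tends to 0 as N grows. This serves when no disagreement is reachable, and to
    contradict exponential convergence of an orbit. *)
Lemma le_geometric_le0 (R : realType) (x C c : R) : 0 < c ->
  (forall N : nat, x <= C * expR (- (c * N%:R))) -> x <= 0.
Proof.
move=> c0 H; rewrite leNgt; apply/negP => x0.
have C0 : 0 < C.
  by have := H 0%N; rewrite mulr0 oppr0 expR0 mulr1; exact: lt_le_trans.
pose N := (Num.trunc (C / (x * c))).+1.
have NH : C / (x * c) < N%:R by exact: truncnS_gt.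
have := H N; apply/negP; rewrite -ltNge expRN ltr_pdivrMr ?expR_gt0//.
apply: (@lt_le_trans _ _ (x * (c * N%:R))).
  by rewrite mulrA -ltr_pdivrMl ?mulr_gt0// mulrC.
by rewrite ler_wpM2l ?(ltW x0)// (le_trans _ (expR_ge1Dx _))// lerDr.
Qed.

(** Carries decay of marginals x / (1 + x) back to ratios. The inverse of this map is Lipschitz only
    on bounded ranges, hence [b]. *)
Lemma prob_dist_le (R : realType) (x y b : R) : 0 <= x <= b -> 0 <= y <= b ->
  `|x - y| <= (1 + b) ^+ 2 * `|x / (1 + x) - y / (1 + y)|.
Proof.
move=> /andP[x0 xb] /andP[y0 yb].
have x1 : 0 < 1 + x by rewrite ltr_pwDl.
have y1 : 0 < 1 + y by rewrite ltr_pwDl.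
have -> : x - y = (1 + x) * (1 + y) * (x / (1 + x) - y / (1 + y)).
  by field; rewrite !gt_eqF.
rewrite normrM ler_wpM2r ?normr_ge0// ger0_norm ?mulr_ge0 ?(ltW x1) ?(ltW y1)//.
by rewrite expr2 ler_pM ?(ltW x1) ?(ltW y1)// lerD2l.
Qed.

Lemma initial_segment_bounded (R : realType) (f : nat -> R) N :
  exists2 S, 0 <= S & forall d, (d < N)%N -> f d <= S.
Proof.
elim: N => [|N [S S0 HS]]; first by exists 0.
exists (Num.max S (f N)); first by rewrite le_max S0.
move=> d; rewrite ltnS leq_eqVlt => /orP[/eqP->|/HS h]; rewrite le_max ?lexx ?orbT//.
by rewrite h.
Qed.

Lemma initial_segment_bounded_lt1 (R : realType) (f : nat -> R) N :
  (forall d, (d < N)%N -> f d < 1) ->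
  exists2 q, 0 < q < 1 & forall d, (d < N)%N -> f d <= q.
Proof.
elim: N => [_|N IH H]; first by exists (1 / 2) => //; apply/andP; split; lra.
have [|q /andP[q0 q1] Hq] := IH; first by move=> d dN; apply: H; exact: ltnW.
exists (Num.max q (f N)).
  by rewrite lt_max q0 gt_max q1 H.
move=> d; rewrite ltnS leq_eqVlt => /orP[/eqP->|/Hq h]; rewrite le_max ?lexx ?orbT//.
by rewrite h.
Qed.

(** * Fields inherited by the neighbours of a removed vertex *)

Section ChildField.
Variable G : sgraph.
Implicit Types (W : {set G}) (k : G -> nat * nat) (u v w : G).

(** [raise0] and [raise1] model the removal of a vertex with neighbours [us], frozen to spin 0 or to
    spin 1. *)
Definition raise0 (us : seq G) k w : nat * nat := (((k w).1 + (w \in us))%N, (k w).2).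
Definition raise1 (us : seq G) k w : nat * nat := ((k w).1, ((k w).2 + (w \in us))%N).

(* The field seen by the neighbour [u] when the telescoping product has already
   switched the preceding neighbours in [us] to spin 0, the others being
   frozen to spin 1. *)
Fixpoint child_field (us : seq G) k u : G -> nat * nat :=
  if us is u0 :: us' then
    if u == u0 then raise1 us' k else child_field us' (raise0 [:: u0] k) u
  else k.

Lemma child_field_notin us k u w : w \notin us -> child_field us k u w = k w.
Proof.
elim: us k => //= u0 us IH k; rewrite inE negb_or => /andP[wu0 wus].
case: ifP => _; first by rewrite /raise1 (negbTE wus) addn0; case: (k w).
by rewrite IH// /raise0 inE (negbTE wu0) addn0; case: (k w).
Qed.

Lemma child_field_self us k u : uniq us -> child_field us k u u = k u.
Proof.
elim: us k => //= u0 us IH k /andP[u0us us_uniq].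
case: eqP => [->|/eqP uu0].
  by rewrite /raise1 (negbTE u0us) addn0; case: (k u0).
by rewrite IH// /raise0 inE (negbTE uu0) addn0; case: (k u).
Qed.

Definition lost (k : nat * nat) := (k.1 + k.2)%N.

(** The position of [w] in [us] decides which spin its lost neighbour has, but one neighbour is lost
    in either case; degrees can thus be tracked without the order. *)
Lemma lost_child_field us k u w : uniq us -> u \in us -> w != u ->
  lost (child_field us k u w) = (lost (k w) + (w \in us))%N.
Proof.
elim: us k => //= u0 us IH k /andP[u0us us_uniq]; rewrite inE.
have [-> _ wu0|uu0 /= uus wu] := eqVneq u u0; rewrite ?IH// /lost inE.
  by rewrite (negbTE wu0) /=; lia.
rewrite /raise0 /= inE; have [->|_] /= := eqVneq w u0; last by lia.
by rewrite (negbTE u0us); lia.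
Qed.

Lemma child_field_congr us k k' u w : k w = k' w ->
  child_field us k u w = child_field us k' u w.
Proof.
elim: us k k' => //= u0 us IH k k' kk'; case: ifP => _; first by rewrite /raise1 kk'.
by apply: IH; rewrite /raise0 kk'.
Qed.

Definition nbrs W v : seq G := enum [set u in W | adj v u].

End ChildField.

(** * The finite [d]-ary tree of depth [n + 1] *)

Section Tree.
Variables d n : nat.

(** A vertex is the word of child indices read from it up to the root: the tail is the parent, the
    empty word is the root, and suffixes are ancestors. *)
Definition tree_vertex := n.+1.-bseq 'I_d.
HB.instance Definition _ := Finite.on tree_vertex.

Definition tree_child (x y : tree_vertex) : bool :=
  if bseqval y is _ :: y' then y' == bseqval x else false.
Definition tree_adj (x y : tree_vertex) : bool := tree_child x y || tree_child y x.

Lemma tree_childP (x y : tree_vertex) :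
  reflect (exists i, bseqval y = i :: bseqval x) (tree_child x y).
Proof.
rewrite /tree_child; case: y => -[|i y] /= yn; apply: (iffP idP) => //.
- by case.
- by move=> /eqP->; exists i.
- by case=> j [_ ->].
Qed.

Lemma tree_child_size (x y : tree_vertex) : tree_child x y ->
  size (bseqval y) = (size (bseqval x)).+1.
Proof. by move=> /tree_childP[i ->]. Qed.

Lemma tree_adj_sym : symmetric tree_adj.
Proof. by move=> x y; rewrite /tree_adj orbC. Qed.

Lemma tree_adj_irrefl : irreflexive tree_adj.
Proof.
move=> x; rewrite /tree_adj orbb; by apply/negP => /tree_child_size/n_Sn.
Qed.

Definition tree : sgraph := SGraph tree_adj_sym tree_adj_irrefl.

(** On a leaf the longer word does not fit and a default vertex results. *)
Definition tree_cons (i : 'I_d) (x : tree) : tree := insub_bseq n.+1 (i :: bseqval x).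

Lemma tree_consE i (x : tree) : (size (bseqval x) <= n)%N ->
  bseqval (tree_cons i x) = i :: bseqval x.
Proof. by move=> xn; rewrite /tree_cons /insub_bseq val_insubd /= ltnS xn. Qed.

Lemma tree_child_cons (x y : tree) : tree_child x y ->
  exists2 i, y = tree_cons i x & (size (bseqval x) <= n)%N.
Proof.
move=> /tree_childP[i yE]; have xn : (size (bseqval x) <= n)%N.
  by have := size_bseq y; rewrite yE.
by exists i => //; apply: val_inj; rewrite /= tree_consE.
Qed.

(** The children, as [Some i], and the parent, as [None], cover all neighbours. *)
Lemma tree_degree (v : tree) : (#|adj v| <= d.+1)%N.
Proof.
pose g (o : option 'I_d) : tree :=
  if o is Some i then tree_cons i v else insub_bseq n.+1 (behead (bseqval v)).
have sub : {subset adj v <= codom g}.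
  move=> w; rewrite unfold_in /= => /orP[/tree_child_cons[i -> _]|].
    by apply/codomP; exists (Some i).
  move=> /tree_childP[i vE]; apply/codomP; exists None; apply: val_inj => /=.
  by rewrite vE /= /insub_bseq val_insubd (size_bseq w).
rewrite (leq_trans (subset_leq_card (introT fintype.subsetP sub)))//.
by rewrite (leq_trans (leq_image_card _ _))// card_option card_ord.
Qed.

Definition tree_root : tree := insub_bseq n.+1 [::].
Definition tree_leaves : {set tree} := [set x : tree | size (bseqval x) == n.+1].

Lemma tree_rootE : bseqval tree_root = [::].
Proof. by rewrite /tree_root /insub_bseq val_insubd. Qed.

Lemma tree_adj_size (x y : tree) : adj x y ->
  (size (bseqval y) <= (size (bseqval x)).+1)%N.
Proof.
move=> /orP[/tree_child_size ->//|/tree_child_size ->].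
by rewrite leqW// leqW.
Qed.

(** An edge changes the depth by at most one. Applied at the root, this bounds the distance to the
    leaves from below. *)
Lemma tree_path_size (x : tree) p : path (@adj tree) x p ->
  (size (bseqval (last x p)) <= size (bseqval x) + size p)%N.
Proof.
elim: p x => [|y p IH] x /=; first by rewrite addn0.
move=> /andP[xy /IH h]; rewrite (leq_trans h)// addnS -addSn leq_add2r.
exact: tree_adj_size.
Qed.

Lemma card_tree_children (v : tree) : (size (bseqval v) <= n)%N ->
  #|[set w : tree | tree_child v w]| = d.
Proof.
move=> vn; rewrite -[RHS]card_ord -(card_imset predT (f := fun i => tree_cons i v)).
  apply: eq_card => w; rewrite inE; apply/idP/imsetP.
    by move=> /tree_child_cons[i -> _]; exists i.
  by case=> i _ ->; apply/tree_childP; exists i; rewrite tree_consE.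
by move=> i j /(congr1 (fun x : tree => bseqval x)) /=; rewrite !tree_consE// => -[].
Qed.

End Tree.

Local Notation no_field := (fun=> (0%N, 0%N)).

(** * Contraction in one step of the recursion *)

Section SpinSystem.
Variables (R : realType) (beta gamma lambda : R).
Hypothesis af : antiferromagnetic beta gamma lambda.

Let b0 : 0 <= beta. Proof. by case: af. Qed.
Let g0 : 0 < gamma. Proof. by case: af. Qed.
Let bg1 : 0 < 1 - beta * gamma. Proof. by case: af => *; rewrite subr_gt0. Qed.
Let l0 : 0 < lambda. Proof. by case: af. Qed.

Definition edge_map (x : R) : R := (beta * x + 1) / (x + gamma).
Definition quad (x : R) : R := (beta * x + 1) * (x + gamma).
(** The quantity (1 - beta gamma) x / [quad x] expressed through y = [edge_map x]. In this form it
    also makes sense for frozen neighbours, y = [beta] > 0 or y = [gamma^-1], and vanishes there. *)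
Definition dual_decay (y : R) : R :=
  (1 + beta * gamma - gamma * y - beta / y) / (1 - beta * gamma).
(** Closed form of the absolute derivative of f_d at its fixed point. *)
Definition slope (d : nat) : R :=
  let x := tree_fixpoint beta gamma lambda d in
  d%:R * (1 - beta * gamma) * x / quad x.

Lemma quad_gt0 x : 0 <= x -> 0 < quad x.
Proof.
by move=> x0; rewrite mulr_gt0 ?ltr_wpDl// mulr_ge0.
Qed.

Lemma edge_map_gt0 x : 0 <= x -> 0 < edge_map x.
Proof.
by move=> x0; rewrite divr_gt0 ?ltr_wpDl// mulr_ge0.
Qed.

Lemma edge_map_le x : 0 <= x -> edge_map x <= gamma^-1.
Proof.
move=> x0; rewrite ler_pdivrMr ?ltr_wpDl// mulrDr mulVf ?gt_eqF// lerD2r.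
apply: ler_wpM2r => //; rewrite -[leRHS]mul1r ler_pdivlMr//.
by rewrite ltW//; move: bg1; lra.
Qed.

Lemma dual_decay_edge_map x : 0 <= x ->
  dual_decay (edge_map x) = (1 - beta * gamma) * (x / quad x).
Proof.
move=> x0; rewrite /dual_decay /edge_map /quad; field.
have h1 : beta * x + 1 != 0 by rewrite gt_eqF// ltr_wpDl// mulr_ge0.
by rewrite h1 !gt_eqF// ltr_wpDl.
Qed.

Lemma dual_decay_beta : 0 < beta -> dual_decay beta = 0.
Proof.
by move=> h; rewrite /dual_decay; field; rewrite !gt_eqF.
Qed.

Lemma dual_decay_gamma : dual_decay gamma^-1 = 0.
Proof.
by rewrite /dual_decay; field; rewrite !gt_eqF.
Qed.

Lemma slope_ge0 d : 0 <= slope d.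
Proof.
have [[x0 _] _] := tree_fixpointP d af.
apply: divr_ge0; last by exact: ltW (quad_gt0 (ltW x0)).
by rewrite !mulr_ge0 ?(ltW bg1) ?(ltW x0).
Qed.

(* In the variable [ln x], [quad x / x] is log-convex and [dual_decay] is
   concave in [ln y]; both tangent lines at the fixed point have the same
   slope, up to sign, so they cancel in the product. *)
Lemma prod_decay_le d (ys : seq R) x : size ys = d -> (0 < d)%N ->
  all (fun y => 0 < y) ys -> x = lambda * \prod_(y <- ys) y ->
  d%:R * (1 - beta * gamma) * x / quad x * \sum_(y <- ys) dual_decay y
    <= slope d * expR (slope d - 1).
Proof.
move=> sd d0 ypos xdef.
have [[xh0 xhE] _] := tree_fixpointP d af.
move: xh0 xhE; set xh := tree_fixpoint _ _ _ _ => xh0 xhE.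
have s0 := slope_ge0 d; set s := slope d in s0 *.
have sE : s = d%:R * (1 - beta * gamma) * xh / quad xh by [].
have q0 : 0 < quad xh by rewrite quad_gt0 ?ltW.
have yh0 := edge_map_gt0 (ltW xh0); set yh := edge_map xh in yh0.
(* Both the derivative of ln ([quad x] / x) in ln x at [xh] and that of [dual_decay] in ln y at
   [yh]. *)
pose l := (beta * xh - gamma / xh) / (quad xh / xh).
have x0 : 0 < x.
  rewrite xdef mulr_gt0// big_seq prodr_gt0// => y yin.
  by have /allP/(_ _ yin) := ypos.
have qx0 : 0 < quad x by rewrite quad_gt0 ?ltW.
pose T := ln (x / xh).
have dn0 : d%:R != 0 :> R by rewrite pnatr_eq0 -lt0n.
have bxh0 : beta * xh + 1 != 0 by rewrite gt_eqF// ltr_wpDl// mulr_ge0// ltW.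
have gxh0 : xh + gamma != 0 by rewrite gt_eqF// ltr_wpDl// ltW.
have xhn0 : xh != 0 by rewrite gt_eqF.
have cn0 : 1 - beta * gamma != 0 by rewrite gt_eqF.
(* The fixed point equation is xh = lambda yh^d, so the logarithmic deviations of the children add
   up to that of x. *)
have lnsum : \sum_(y <- ys) ln (y / yh) = T.
  have xhE' : xh = lambda * yh ^+ size ys by rewrite sd -[LHS]xhE.
  rewrite /T xdef xhE' -mulf_div divff ?gt_eqF// mul1r.
  elim: ys ypos {x xdef x0 qx0 T sd xhE'} => [_|y ys IH /= /andP[y0 ypos]].
    by rewrite !big_nil expr0 divr1 ln1.
  have P0 : 0 < \prod_(z <- ys) z.
    by rewrite big_seq prodr_gt0// => z zin; have /allP/(_ _ zin) := ypos.
  by rewrite !big_cons IH// exprS -mulf_div [in RHS]lnM// posrE divr_gt0 ?exprn_gt0.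
have H1 y : 0 < y -> dual_decay y <= s / d%:R + l * ln (y / yh).
  move=> y0; set t := ln _.
  have yE : y = yh * expR t.
    have -> : expR t = y / yh by apply: lnK; rewrite posrE divr_gt0.
    by rewrite mulrC divfK// gt_eqF.
  have yVE : y^-1 = yh^-1 * expR (- t) by rewrite yE invfM expRN.
  have -> : s / d%:R + l * t = (1 + beta * gamma - gamma * yh * (1 + t)
       - beta / yh * (1 - t)) / (1 - beta * gamma).
    rewrite sE /l /yh /edge_map /quad; field.
    by rewrite dn0 bxh0 gxh0 xhn0 cn0.
  rewrite /dual_decay ler_pM2r ?invr_gt0// yVE {1}yE.
  have e1 := expR_ge1Dx t; have e2 := expR_ge1Dx (- t).
  have := ler_wpM2l (ltW (mulr_gt0 g0 yh0)) e1.
  have := ler_wpM2l (divr_ge0 b0 (ltW yh0)) e2.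
  by rewrite !mulrA; lra.
have H2 : \sum_(y <- ys) dual_decay y <= s + l * T.
  have -> : s + l * T = \sum_(y <- ys) (s / d%:R + l * ln (y / yh)).
    rewrite big_split /= -[X in _ = _ + X]mulr_sumr lnsum; congr (_ + _).
    rewrite big_const_seq count_predT sd iter_addr_0 -[RHS]mulr_natr divfK//.
  rewrite big_seq [leRHS]big_seq ler_sum// => y yin; apply: H1.
  by have /allP/(_ _ yin) := ypos.
have H3 : quad xh / xh * expR (l * T) <= quad x / x.
  set r := l * T.
  have xE : x = xh * expR T.
    have -> : expR T = x / xh by apply: lnK; rewrite posrE divr_gt0.
    by rewrite mulrC divfK.
  have xVE : x^-1 = xh^-1 * expR (- T) by rewrite xE invfM expRN.
  have -> : quad x / x = beta * xh * expR T + gamma / xh * expR (- T) + (1 + beta * gamma).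
    rewrite -!mulrA -xE -xVE /quad; field; by rewrite gt_eqF.
  (* Jensen's inequality for exp: the points T, -T, 0 with weights beta xh, gamma / xh, 1 + beta
     gamma have mean r = l T, so the linear terms of the tangent at r cancel. *)
  have E t : expR r * (1 + (t - r)) <= expR t.
    have -> : expR t = expR r * expR (t - r) by rewrite -expRD; congr expR; ring.
    by rewrite ler_wpM2l ?expR_ge0// expR_ge1Dx.
  have e1 := ler_wpM2l (mulr_ge0 b0 (ltW xh0)) (E T).
  have e2 := ler_wpM2l (ltW (divr_gt0 g0 xh0)) (E (- T)).
  have O0 : 0 <= 1 + beta * gamma by rewrite addr_ge0// mulr_ge0// ltW.
  have := ler_wpM2l O0 (E 0); rewrite expR0 mulr1 => e3.
  have -> : quad xh / xh * expR r = beta * xh * (expR r * (1 + (T - r))) +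
      gamma / xh * (expR r * (1 + (- T - r))) +
      (1 + beta * gamma) * (expR r * (1 + (0 - r))).
    rewrite {2 3 4 5 6 7}/r /l /quad; field.
    by rewrite bxh0 gxh0 xhn0.
  by lra.
have H4 : d%:R * (1 - beta * gamma) * x / quad x <= s * expR (- (l * T)).
  have -> : d%:R * (1 - beta * gamma) * x / quad x =
     d%:R * (1 - beta * gamma) / (quad x / x).
    by rewrite invf_div mulrA.
  have -> : s * expR (- (l * T)) =
     d%:R * (1 - beta * gamma) / (quad xh / xh * expR (l * T)).
    rewrite expRN sE; field; by rewrite !gt_eqF// expR_gt0.
  rewrite ler_wpM2l ?mulr_ge0 ?(ltW bg1)// lef_pV2// posrE.
    by rewrite divr_gt0.
  by rewrite mulr_gt0 ?expR_gt0// divr_gt0.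
have A0 : 0 <= d%:R * (1 - beta * gamma) * x / quad x.
  by rewrite divr_ge0 ?(ltW qx0)// !mulr_ge0 ?(ltW bg1) ?(ltW x0).
apply: le_trans (ler_wpM2l A0 H2) _.
(* The worst case is l T = 1 - s; if the second factor is negative, the left side is at most 0. *)
have [nn|] := leP 0 (s + l * T).
  apply: le_trans (ler_wpM2r nn H4) _; exact: mul_expRN_le.
move=> neg; apply: (@le_trans _ _ 0).
  by rewrite mulr_ge0_le0// ltW.
by rewrite mulr_ge0 ?expR_ge0.
Qed.

(** The ratio at a vertex all of whose neighbours are frozen, [k.1] of them to spin 0 and [k.2] to
    spin 1. *)
Definition field_ratio (k : nat * nat) : R :=
  lambda * beta ^+ k.1 * gamma ^- k.2.

Lemma field_ratio_ge0 k : 0 <= field_ratio k.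
Proof. by rewrite !mulr_ge0 ?exprn_ge0 ?invr_ge0 ?exprn_ge0 ?(ltW l0) ?(ltW g0). Qed.

(** The logarithmic derivative of [edge_map] is -(1 - beta gamma) / [quad]. *)
Lemma is_derive_edge_map_comp (X : R -> R) (dX t : R) :
  is_derive t 1 X dX -> 0 <= X t ->
  is_derive t 1 (fun t => edge_map (X t))
    (edge_map (X t) * (- (1 - beta * gamma) * (dX / quad (X t)))).
Proof.
move=> HX X0.
have n1 : X t + gamma != 0 by rewrite gt_eqF// ltr_wpDl.
have n2 : beta * X t + 1 != 0 by rewrite gt_eqF// ltr_wpDl// mulr_ge0.
have h := is_derive_tree_map beta 1 1 n1.
have eE : tree_map beta gamma 1 1 = edge_map.
  by apply/funext => y; rewrite /tree_map /edge_map mul1r expr1.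
rewrite eE in h.
apply: (is_derive_eq (@is_derive1_comp R edge_map X t _ _ h HX)).
rewrite /= expr0 /edge_map /quad mulr1n; field.
by rewrite n1 n2.
Qed.

Lemma is_derive_prod_edge_map (I : eqType) (us : seq I) (X dX : I -> R -> R) (t : R) :
  (forall u, u \in us -> is_derive t 1 (X u) (dX u t) /\ 0 <= X u t) ->
  is_derive t 1 (fun t => \prod_(u <- us) edge_map (X u t))
    (\prod_(u <- us) edge_map (X u t) *
      (- (1 - beta * gamma) * \sum_(u <- us) dX u t / quad (X u t))).
Proof.
elim: us => [_|u us IH H].
  under eq_fun do rewrite big_nil.
  by rewrite !big_nil !mulr0; exact: is_derive_cst.
have [Hu u0] := H u (mem_head _ _).
have h1 := is_derive_edge_map_comp Hu u0.
have /IH h2 : forall w, w \in us -> is_derive t 1 (X w) (dX w t) /\ 0 <= X w t.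
  by move=> w win; apply: H; rewrite inE win orbT.
under eq_fun do rewrite big_cons.
apply: (is_derive_eq (is_deriveM h1 h2)).
rewrite !big_cons /GRing.scale /=; ring.
Qed.

(* The curve has speed at most [sqrt M] for the Li-Lu-Yin metric
   [|dx| / sqrt (x (beta x + 1) (x + gamma))]. *)
Definition tame (M : R) (X : R -> R) : Prop :=
  forall t : R, 0 <= X t /\
    exists2 dX, is_derive t 1 X dX & dX ^+ 2 <= M * (X t * quad (X t)).

Lemma tame_le M M' X : M <= M' -> tame M X -> tame M' X.
Proof.
move=> MM' H t; have [X0 [dX d1 d2]] := H t; split=> //; exists dX => //.
apply: le_trans d2 _; rewrite ler_wpM2r// mulr_ge0//.
by rewrite ltW// quad_gt0.
Qed.

Lemma tame_const M x : 0 <= M -> 0 <= x -> tame M (fun=> x).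
Proof.
move=> M0 x0 t; split=> //; exists 0; first exact: is_derive_cst.
by rewrite expr0n/= mulr_ge0// mulr_ge0// (ltW (quad_gt0 x0)).
Qed.

(** Moving the square root linearly cancels the singularity of the metric at 0, so the speed stays
    bounded even if an end is 0. *)
Lemma tame_square x x' m : 0 <= x <= m -> 0 <= x' <= m ->
  exists X, [/\ tame (4 * m / gamma) X, X 0 = x & X 1 = x'].
Proof.
move=> /andP[x0 xm] /andP[x'0 x'm].
pose a := Num.sqrt x; pose a' := Num.sqrt x'.
exists (fun t => (a + t * (a' - a)) ^+ 2).
have aE : a ^+ 2 = x by rewrite sqr_sqrtr.
have a'E : a' ^+ 2 = x' by rewrite sqr_sqrtr.
have a0 : 0 <= a by exact: sqrtr_ge0.
have a'0 : 0 <= a' by exact: sqrtr_ge0.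
split; last 2 first.
- by rewrite mul0r addr0.
- by rewrite mul1r addrC subrK.
move=> t; split; first exact: sqr_ge0.
exists (2 * (a + t * (a' - a)) * (a' - a)).
  by apply: is_derive_eq; rewrite /GRing.scale /= ; ring.
set Y := a + t * _.
have Q : gamma <= quad (Y ^+ 2).
  rewrite /quad.
  have h1 : 1 <= beta * Y ^+ 2 + 1 by rewrite lerDr mulr_ge0// sqr_ge0.
  have h2 : gamma <= Y ^+ 2 + gamma by rewrite lerDr sqr_ge0.
  by rewrite -[leLHS]mul1r ler_pM// ltW.
have D : (a' - a) ^+ 2 <= m.
  have aa' := mulr_ge0 a0 a'0; rewrite sqrrB aE a'E.
  have [h|/ltW h] := leP a a'.
    by have := ler_wpM2l a0 h; rewrite -expr2 aE (mulrC a); move: x'm aa'; lra.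
  by have := ler_wpM2l a'0 h; rewrite -expr2 a'E; move: xm aa'; lra.
have m0 : 0 <= m by exact: le_trans xm.
have -> : (2 * Y * (a' - a)) ^+ 2 = 4 * Y ^+ 2 * (a' - a) ^+ 2 by ring.
have -> : 4 * m / gamma * (Y ^+ 2 * quad (Y ^+ 2)) =
  4 * Y ^+ 2 * (m * (quad (Y ^+ 2) / gamma)) by ring.
apply: ler_wpM2l; first by rewrite mulr_ge0 ?sqr_ge0.
by apply: le_trans D _; rewrite ler_peMr// ler_pdivlMr// mul1r.
Qed.

(** The contraction is that of f_d for the total number [d] of children, frozen ones included. *)
Lemma tame_step (I : eqType) (us : seq I) (k : nat * nat) (X : I -> R -> R) M :
  0 <= M -> (forall u, u \in us -> tame M (X u)) ->
  let d := (k.1 + k.2 + size us)%N in (0 < d)%N ->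
  tame (slope d * expR (slope d - 1) * M)
    (fun t => field_ratio k * \prod_(u <- us) edge_map (X u t)).
Proof.
move=> M0 H d d0 t.
have /choice[dX HdX] : forall u, exists dx, u \in us ->
   is_derive t 1 (X u) dx /\ dx ^+ 2 <= M * (X u t * quad (X u t)).
  move=> u; have [uin|] := boolP (u \in us); last by exists 0.
  by have [_ [dx h1 h2]] := H u uin t; exists dx.
have X0 u : u \in us -> 0 <= X u t by move=> uin; have [] := H u uin t.
have P0 : 0 < \prod_(u <- us) edge_map (X u t).
  by rewrite big_seq prodr_gt0// => u uin; rewrite edge_map_gt0// X0.
set x := field_ratio k * _.
have x0 : 0 <= x by rewrite mulr_ge0 ?field_ratio_ge0// ltW.
split=> //.
exists (x * (- (1 - beta * gamma) * \sum_(u <- us) dX u / quad (X u t))).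
  have /is_derive_prod_edge_map h :
      forall u, u \in us -> is_derive t 1 (X u) (dX u) /\ 0 <= X u t.
    by move=> u uin; split; [have [] := HdX u uin | exact: X0].
  apply: (is_derive_eq (@is_deriveZ _ _ _ _ (field_ratio k) _ _ _ h)).
  by rewrite /GRing.scale /= /x mulrA.
(* The value 0 occurs only for [beta] = 0 with a neighbour frozen to spin 0; the derivative is then
   0 as well. *)
have [x00|xn0] := eqVneq x 0.
  by rewrite x00 !mul0r mulr0 expr0n.
have {xn0} xpos : 0 < x by rewrite lt_neqAle eq_sym xn0.
have qx0 : 0 < quad x by rewrite quad_gt0.
have kb : (0 < k.1)%N -> 0 < beta.
  move=> k1; rewrite lt_neqAle b0 andbT; apply: contraTneq xpos => b00.
  by rewrite /x /field_ratio -b00 expr0n gtn_eqF// mulr0 !mul0r ltxx.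
(* The factors of all [d] children. Those of frozen ones have [dual_decay] 0, so only free children
   remain in the sum. *)
pose ys := nseq k.1 beta ++ nseq k.2 gamma^-1 ++ [seq edge_map (X u t) | u <- us].
have ysz : size ys = d by rewrite !size_cat !size_nseq size_map addnA.
have yp : all (fun y => 0 < y) ys.
  apply/allP => y; rewrite !mem_cat !mem_nseq => /or3P[/andP[k0 /eqP->]||].
  - exact: kb.
  - by move=> /andP[_ /eqP->]; rewrite invr_gt0.
  - by case/mapP => u uin ->; rewrite edge_map_gt0// X0.
have xE : x = lambda * \prod_(y <- ys) y.
  rewrite /ys !big_cat /= !big_nseq big_map !iter_mulr_1 /x /field_ratio.
  by rewrite exprVn !mulrA.
have core := prod_decay_le ysz d0 yp xE.
have hsum : \sum_(y <- ys) dual_decay y =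
   (1 - beta * gamma) * \sum_(u <- us) (X u t / quad (X u t)).
  rewrite /ys !big_cat /= !big_nseq big_map.
  rewrite dual_decay_gamma !iter_addr_0 mul0rn add0r.
  have -> : dual_decay beta *+ k.1 = 0.
    case: (posnP k.1) => [->|k0]; first by rewrite mulr0n.
    by rewrite dual_decay_beta ?kb// mul0rn.
  rewrite add0r mulr_sumr big_seq [RHS]big_seq; apply: eq_bigr => u uin.
  by rewrite dual_decay_edge_map// X0.
rewrite hsum in core.
set Sg := \sum_(u <- us) dX u / quad (X u t).
set Sh := \sum_(u <- us) (X u t / quad (X u t)) in core.
have Sh0 : 0 <= Sh.
  rewrite /Sh big_seq sumr_ge0// => u uin; rewrite divr_ge0 ?X0//.
  by rewrite ltW// quad_gt0// X0.
(* Cauchy-Schwarz, with the number of free children enlarged to [d] to match [core]. *)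
have hS : Sg ^+ 2 <= d%:R * (M * Sh).
  apply: le_trans (sum_sqr_le _ _) _.
  apply: ler_pM => //; first by rewrite sumr_ge0// => u _; exact: sqr_ge0.
    by rewrite ler_nat leq_addl.
  rewrite mulr_sumr big_seq [leRHS]big_seq ler_sum// => u uin.
  have q0 : 0 < quad (X u t) by rewrite quad_gt0// X0.
  have [_] := HdX u uin.
  rewrite expr_div_n ler_pdivrMr ?exprn_gt0// => h; apply: le_trans h _.
  rewrite expr2 [leRHS](_ : _ = M * (X u t * quad (X u t)))//.
  by field; rewrite gt_eqF.
have -> : (x * (- (1 - beta * gamma) * Sg)) ^+ 2 =
   x ^+ 2 * (1 - beta * gamma) ^+ 2 * Sg ^+ 2 by ring.
apply: (@le_trans _ _ (x ^+ 2 * (1 - beta * gamma) ^+ 2 * (d%:R * (M * Sh)))).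
  by rewrite ler_wpM2l// mulr_ge0// sqr_ge0.
have -> : x ^+ 2 * (1 - beta * gamma) ^+ 2 * (d%:R * (M * Sh)) =
  d%:R * (1 - beta * gamma) * x / quad x * ((1 - beta * gamma) * Sh) *
  (M * (x * quad x)).
  by field; rewrite gt_eqF.
rewrite -[leRHS]mulrA; apply: ler_wpM2r => //.
by rewrite mulr_ge0// mulr_ge0// ltW.
Qed.

(** * Spin ratios on a graph and their recursion *)

Section Recursion.
Variable G : sgraph.

Local Notation edge_weight := (edge_weight beta gamma).

Implicit Types (W L : {set G}) (k : G -> nat * nat) (s t : config G) (u v w : G).

(* [k u = (i, j)] records that [u] has lost [i] neighbours frozen to spin 0 and
   [j] neighbours frozen to spin 1; their influence is an external field. *)
Definition sub_weight W k s : R :=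
  (\prod_(e : G * G | [&& adj e.1 e.2, (enum_rank e.1 < enum_rank e.2)%N,
      e.1 \in W & e.2 \in W]) edge_weight (s e.1) (s e.2)) *
  \prod_(u in W) (if s u then 1 else field_ratio (k u)).

Definition freeze L t k u : nat * nat :=
  ((k u).1 + #|[set w in L | adj w u && ~~ t w]|,
   (k u).2 + #|[set w in L | adj w u && t w]|)%N.

Definition all_true : config G := [ffun=> true].

(** Each configuration of [W] is represented once, by its extension with value true outside [W]. *)
Definition sub_sum W k : R :=
  \sum_(s | agree_on (~: W) all_true s) sub_weight W k s.

Definition sub_sum_at W k v (b : bool) : R :=
  \sum_(s | agree_on (~: W) all_true s && (s v == b)) sub_weight W k s.

Definition spin_ratio W k v : R :=
  sub_sum_at W k v false / sub_sum_at W k v true.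

Lemma edge_weight_ge0 a b : 0 <= edge_weight a b.
Proof. by case: a b => [] [] //=; rewrite ltW. Qed.

Lemma edge_weight_sym a b : edge_weight a b = edge_weight b a.
Proof. by case: a b => [] []. Qed.

Lemma sub_weight_ge0 W k s : 0 <= sub_weight W k s.
Proof.
rewrite mulr_ge0// prodr_ge0// => *; first exact: edge_weight_ge0.
by case: ifP => // _; exact: field_ratio_ge0.
Qed.

Lemma eq_sub_weight W k k' s s' : {in W, k =1 k'} -> {in W, s =1 s'} ->
  sub_weight W k s = sub_weight W k' s'.
Proof.
move=> kk' ss'; congr (_ * _); apply: eq_bigr.
  by move=> e /and4P[_ _ h1 h2]; rewrite !ss'.
by move=> u uW; rewrite ss'// kk'.
Qed.

Lemma eq_sub_sum W k k' : {in W, k =1 k'} -> sub_sum W k = sub_sum W k'.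
Proof. by move=> kk'; apply: eq_bigr => s _; exact: eq_sub_weight. Qed.

Lemma sub_weight_true_gt0 W k s : {in W, forall u, s u} -> 0 < sub_weight W k s.
Proof.
move=> sT; apply: mulr_gt0; apply: prodr_gt0.
  by move=> e /and4P[_ _ h1 h2]; rewrite !sT.
by move=> u uW; rewrite sT.
Qed.

(** As [gamma] > 0, the configuration with all spins 1 has positive weight. Ratios therefore have
    spin 1 in the denominator; spin 0 can have weight 0 when [beta] = 0. *)
Lemma sub_sum_at_true_gt0 W k v : 0 < sub_sum_at W k v true.
Proof.
rewrite /sub_sum_at (bigD1 all_true)/=; last first.
  by rewrite ffunE eqxx andbT; apply/forall_inP.
rewrite ltr_wpDr ?sumr_ge0// => [*|]; first exact: sub_weight_ge0.
by apply: sub_weight_true_gt0 => u _; rewrite ffunE.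
Qed.

Lemma sub_sum_at_ge0 W k v b : 0 <= sub_sum_at W k v b.
Proof. by rewrite sumr_ge0// => *; exact: sub_weight_ge0. Qed.

Lemma spin_ratio_ge0 W k v : 0 <= spin_ratio W k v.
Proof. by rewrite divr_ge0 ?sub_sum_at_ge0. Qed.

Lemma sub_sumE W k v : sub_sum W k = sub_sum_at W k v false + sub_sum_at W k v true.
Proof.
rewrite /sub_sum (bigID (fun s : config G => s v == false)) /=; congr (_ + _).
by apply: eq_bigl => s; case: (s v).
Qed.

Lemma sub_sum_gt0 v W k : 0 < sub_sum W k.
Proof.
rewrite (sub_sumE _ _ v) ltr_wpDl ?sub_sum_at_ge0//.
exact: sub_sum_at_true_gt0.
Qed.

(** Overwriting the values outside [W] is a bijection between the two index sets. *)
Lemma sum_agree_indep W t t' (F : config G -> R) :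
  (forall s s', {in W, s =1 s'} -> F s = F s') ->
  \sum_(s | agree_on (~: W) t s) F s = \sum_(s | agree_on (~: W) t' s) F s.
Proof.
move=> HF.
pose merge t s : config G := [ffun u => if u \in W then s u else t u].
have mK t1 t2 s : agree_on (~: W) t1 s -> merge t1 (merge t2 s) = s.
  move=> /forall_inP h; apply/ffunP => u; rewrite !ffunE.
  case uW: (u \in W) => //; apply/esym/eqP.
  by apply: h; rewrite inE uW.
rewrite (reindex_onto (merge t) (merge t')) /=; last by move=> s; exact: mK.
apply: eq_big => [s|s _].
  have -> : agree_on (~: W) t (merge t s).
    by apply/forall_inP => u; rewrite inE ffunE => /negbTE ->.
  apply/eqP/idP => [<-|].
    by apply/forall_inP => u; rewrite inE ffunE => /negbTE ->.
  exact: mK.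
by apply: HF => u uW; rewrite ffunE uW.
Qed.

Lemma prod_edge_weight (A : {set G}) s u :
  \prod_(w in A) edge_weight (s w) (s u) =
  if s u then gamma ^+ #|[set w in A | s w]|
  else beta ^+ #|[set w in A | ~~ s w]|.
Proof.
have E (p : pred G) (x : R) :
  \prod_(w in A) (if p w then x else 1) = x ^+ #|[set w in A | p w]|.
  rewrite -big_mkcondr prodr_const; congr (_ ^+ _); apply: eq_card => w.
  by rewrite !inE.
case: (s u); rewrite -E; apply: eq_bigr => w _; by case: (s w).
Qed.

(** Fields are normalised to weight 1 on spin 1. A neighbour of spin 0 gives the weights [beta] and
    1; one of spin 1 gives 1 and [gamma], so [gamma] is factored out and spin 0 keeps [gamma^-1]. *)
Lemma sub_weight_split L W k s : [disjoint L & W] ->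
  sub_weight (L :|: W) k s =
  sub_weight L k s * (\prod_(u in W) gamma ^+ #|[set w in L | adj w u && s w]|)
  * sub_weight W (freeze L s k) s.
Proof.
move=> dis; rewrite /sub_weight.
have LW u : u \in L -> u \notin W by move=> uL; rewrite (disjointFr dis).
pose ew (e : G * G) := edge_weight (s e.1) (s e.2).
have edges : \prod_(e : G * G | [&& adj e.1 e.2, (enum_rank e.1 < enum_rank e.2)%N,
      e.1 \in L :|: W & e.2 \in L :|: W]) ew e =
  (\prod_(e : G * G | [&& adj e.1 e.2, (enum_rank e.1 < enum_rank e.2)%N,
      e.1 \in L & e.2 \in L]) ew e) *
  (\prod_(e : G * G | [&& adj e.1 e.2, (enum_rank e.1 < enum_rank e.2)%N,
      e.1 \in W & e.2 \in W]) ew e) *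
  (\prod_(u in W) \prod_(w in L | adj w u) edge_weight (s w) (s u)).
  rewrite pair_big_dep /= (bigID (fun e : G * G => e.1 \in L)) /=.
  rewrite (bigID (fun e : G * G => e.2 \in L)) /=.
  rewrite [X in _ * X](bigID (fun e : G * G => e.2 \in L)) /=.
  rewrite -!mulrA; congr (_ * _).
    apply: eq_bigl => e; rewrite !inE.
    case e1L: (e.1 \in L); case e2L: (e.2 \in L); by rewrite ?andbT ?andbF.
  rewrite mulrCA [RHS]mulrC mulrA; congr (_ * _); last first.
    apply: eq_bigl => e; rewrite !inE.
    case e1L: (e.1 \in L); first by rewrite (negbTE (LW _ e1L)) ?andbF.
    case e2L: (e.2 \in L); first by rewrite (negbTE (LW _ e2L)) ?andbF.
    by rewrite ?andbT.
  (* An edge between [L] and [W] is listed by rank, so either end may come first; exchanging the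
     ends matches the second case. *)
  rewrite [RHS](bigID (fun e : G * G => (enum_rank e.1 < enum_rank e.2)%N)) /=.
  congr (_ * _).
    apply: eq_big => [e|e _]; last by rewrite edge_weight_sym.
    rewrite !inE (adj_sym e.2).
    case e1L: (e.1 \in L); first by rewrite (negbTE (LW _ e1L)) ?andbF.
    case: (e.2 \in L); case: (e.1 \in W); case: (adj _ _);
      by case: (enum_rank e.1 < enum_rank e.2)%N; rewrite ?andbF.
  rewrite (reindex_inj (h := fun e : G * G => (e.2, e.1))) /=; last first.
    by move=> [a b] [c d] [-> ->].
  apply: eq_big => // e; rewrite !inE.
  case e1L: (e.1 \in L); first by rewrite (negbTE (LW _ e1L)) ?andbF.
  rewrite -leqNgt [in RHS]leq_eqVlt.
  case e2L: (e.2 \in L); rewrite ?andbT ?andbF//=.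
  case a: (adj e.2 e.1) => //=; rewrite ?andbF//.
  rewrite andbT andbC; congr (_ && _); case: eqP => // /val_inj/enum_rank_inj h.
  by move: a; rewrite h adj_irrefl.
rewrite edges [X in _ * X = _](bigID (fun u => u \in L)) /=.
have -> : \prod_(i in L :|: W | i \in L) (if s i then 1 else field_ratio (k i)) =
  \prod_(i in L) (if s i then 1 else field_ratio (k i)).
  by apply: eq_bigl => u; rewrite inE; case: (u \in L); rewrite ?andbF.
have -> : \prod_(i in L :|: W | i \notin L) (if s i then 1 else field_ratio (k i)) =
  \prod_(i in W) (if s i then 1 else field_ratio (k i)).
  apply: eq_bigl => u; rewrite inE; case uL : (u \in L); rewrite ?andbT ?andbF//.
  by rewrite (negbTE (LW _ uL)).
have -> : \prod_(u in W) \prod_(w in L | adj w u) edge_weight (s w) (s u) =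
   \prod_(u in W) (if s u then gamma ^+ #|[set w in L | adj w u && s w]|
     else beta ^+ #|[set w in L | adj w u && ~~ s w]|).
  apply: eq_bigr => u _.
  have := prod_edge_weight [set w in L | adj w u] s u.
  under eq_bigl do rewrite inE; move=> ->.
  by case: (s u); congr (_ ^+ _); apply: eq_card => w; rewrite !inE andbA.
set A := (X in X * _ * _ * _ = _); set B := (X in _ * X * _ * _ = _).
set C := (X in _ * X * _ = _); set D := (X in _ * (X * _) = _).
set E := (X in _ * (_ * X) = _); set P := (X in _ = _ * X * _).
have -> : A * B * C * (D * E) = A * D * B * (C * E) by ring.
have -> : A * D * P * (B * \prod_(u in W) (if s u then 1 else field_ratio (freeze L s k u)))
  = A * D * B * (P * \prod_(u in W) (if s u then 1 else field_ratio (freeze L s k u)))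
  by ring.
congr (_ * _); rewrite -!big_split; apply: eq_bigr => u _ /=.
case: (s u); first by rewrite mulr1.
rewrite /field_ratio /= !exprD; field.
by rewrite !expf_neq0// gt_eqF.
Qed.

Lemma freeze_congr L t t' k u :
  (forall w, w \in L -> adj w u -> t w = t' w) -> freeze L t k u = freeze L t' k u.
Proof.
move=> tt'; rewrite /freeze; congr (_ + _, _ + _)%N; apply: eq_card => w;
  rewrite !inE; case wL: (w \in L) => //=; case wu: (adj w u) => //=; by rewrite tt'.
Qed.

Lemma sub_sum_at_freeze W k v b : v \in W ->
  sub_sum_at W k v b =
  (if b then gamma ^+ #|[set u in W | adj v u]| else field_ratio (k v)) *
  sub_sum (W :\ v) (freeze [set v] [ffun=> b] k).
Proof.
move=> vW; rewrite /sub_sum_at /sub_sum mulr_sumr.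
(* Values outside [W :\ v] do not affect the summand, so [v] may be pinned to [b] instead of
   true. *)
pose tb : config G := [ffun u => if u == v then b else true].
have -> : \sum_(s | agree_on (~: (W :\ v)) all_true s)
    (if b then gamma ^+ #|[set u in W | adj v u]| else field_ratio (k v)) *
     sub_weight (W :\ v) (freeze [set v] [ffun=> b] k) s =
   \sum_(s | agree_on (~: (W :\ v)) tb s)
    (if b then gamma ^+ #|[set u in W | adj v u]| else field_ratio (k v)) *
     sub_weight (W :\ v) (freeze [set v] [ffun=> b] k) s.
  by apply: sum_agree_indep => s s' ss'; congr (_ * _); apply: eq_sub_weight.
have vE : (v |: (W :\ v)) = W by rewrite finset.setD1K.
apply: eq_big => [s|s /andP[_ /eqP sv]].
  apply/andP/forall_inP => [[/forall_inP h1 /eqP h2] u|h].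
    rewrite !inE ffunE negb_and negbK; case: eqP => [->|_ /= uW]; first by rewrite h2.
    by have := h1 u; rewrite inE ffunE => ->.
  split; last by have := h v; rewrite !inE ffunE !eqxx => ->.
  apply/forall_inP => u; rewrite inE => uW; have := h u.
  rewrite !inE !ffunE (negbTE uW) andbF => /(_ isT).
  by case: (eqVneq u v) uW => // ->; rewrite vW.
rewrite -{1}vE sub_weight_split; last by rewrite disjoints1 !inE eqxx.
have -> : sub_weight [set v] k s = if b then 1 else field_ratio (k v).
  rewrite /sub_weight; set A := (X in X * _); have -> : A = 1.
    apply: big_pred0 => e; apply/negbTE/negP => /and4P[+ _ /set1P h1 /set1P h2].
    by rewrite h1 h2 adj_irrefl.
  by rewrite mul1r big_set1 sv.
have -> : \prod_(u in W :\ v) gamma ^+ #|[set w in [set v] | adj w u && s w]| =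
   if b then gamma ^+ #|[set u in W | adj v u]| else 1.
  case: b sv {tb} => sv; last first.
    rewrite big1// => u _; have -> : [set w in [set v] | adj w u && s w] = finset.set0.
      apply/setP => w; rewrite !inE; case: eqP => // ->; by rewrite sv andbF.
    by rewrite cards0.
  rewrite -[RHS]prodr_const [LHS]big_mkcond [RHS]big_mkcond; apply: eq_bigr => u _.
  rewrite !inE; case: (eqVneq u v) => [->|uv] /=; first by rewrite adj_irrefl andbF.
  case: (u \in W) => //=; case: ifP => vu.
    have -> : [set w in [set v] | adj w u && s w] = [set v].
      by apply/setP => w; rewrite !inE; case: eqP => // ->; rewrite sv vu.
    by rewrite cards1.
  have -> : [set w in [set v] | adj w u && s w] = finset.set0.
    by apply/setP => w; rewrite !inE; case: eqP => // ->; rewrite vu.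
  by rewrite cards0.
congr (_ * _); first by case: (b); rewrite ?mulr1 ?mul1r.
apply: eq_sub_weight => // u _; apply: freeze_congr => w.
by rewrite inE => /eqP -> _; rewrite ffunE.
Qed.

Lemma freeze1 v b k u : freeze [set v] [ffun=> b] k u =
  if b then ((k u).1, (k u).2 + adj v u)%N else ((k u).1 + adj v u, (k u).2)%N.
Proof.
have E (p : pred G) : #|[set w in [set v] | p w]| = p v.
  case pv : (p v).
    by rewrite -[RHS]/1%N -(cards1 v); apply: eq_card => w; rewrite !inE; case: eqP => // ->.
  by apply: eq_card0 => w; rewrite !inE; case: eqP => // ->.
by rewrite /freeze !E !ffunE; case: b; rewrite ?andbT ?andbF ?addn0.
Qed.

(** The field of [u] only acts on configurations with spin 0 at [u]. One more lost neighbour means c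
    = [beta] or c = [gamma^-1]. *)
Lemma sub_sum_raise (c : R) W k k' u : u \in W ->
  (forall w, w != u -> k' w = k w) -> field_ratio (k' u) = c * field_ratio (k u) ->
  sub_sum W k' = sub_sum_at W k u true + c * sub_sum_at W k u false.
Proof.
move=> uW kk' ku; rewrite (sub_sumE _ _ u) addrC /sub_sum_at mulr_sumr.
congr (_ + _); apply: eq_bigr => s /andP[_ /eqP su]; rewrite /sub_weight.
  congr (_ * _); apply: eq_bigr => w _; case: (eqVneq w u) => [->|/kk'->//].
  by rewrite su.
rewrite mulrCA; congr (_ * _); rewrite (bigD1 u)//= [in RHS](bigD1 u)//= su ku.
rewrite mulrA; congr (_ * _); apply: eq_bigr => w /andP[_ /kk' ->] //.
Qed.

(** Neighbours switch from [raise1] to [raise0] one at a time. A switch at ratio r contributes (1 +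
    beta r) / (1 + r / gamma), which is [gamma] times [edge_map r]. *)
Lemma spin_ratio_telescope W us k : uniq us -> {subset us <= W} ->
  sub_sum W (raise0 us k) = gamma ^+ size us * sub_sum W (raise1 us k) *
  \prod_(u <- us) edge_map (spin_ratio W (child_field us k u) u).
Proof.
elim: us k => [|u us IH] k /=.
  rewrite big_nil expr0 mul1r mulr1 => _ _; apply: eq_sub_sum => w _.
  by rewrite /raise0 /raise1 !addn0.
move=> /andP[uus uniq_us] sub.
have uW : u \in W by apply: sub; rewrite mem_head.
have usW : {subset us <= W} by move=> w wus; apply: sub; rewrite inE wus orbT.
have -> : sub_sum W (raise0 (u :: us) k) = sub_sum W (raise0 us (raise0 [:: u] k)).
  apply: eq_sub_sum => w _; rewrite /raise0 /= !inE; congr (_, _).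
  case: (eqVneq w u) => [->|_] /=; first by rewrite (negbTE uus) addn0.
  by rewrite addn0.
rewrite IH// big_cons eqxx exprS.
set k2 := raise1 us k.
have -> : sub_sum W (raise1 us (raise0 [:: u] k)) =
  gamma * edge_map (spin_ratio W k2 u) * sub_sum W (raise1 (u :: us) k).
  have e1 := @sub_sum_raise beta W k2 (raise1 us (raise0 [:: u] k)) u uW.
  have e2 := @sub_sum_raise gamma^-1 W k2 (raise1 (u :: us) k) u uW.
  rewrite e1; first last.
  - rewrite /field_ratio /= inE eqxx addn1 exprS; ring.
  - by move=> w wu; rewrite /raise1 /raise0 /= inE (negbTE wu) addn0.
  rewrite e2; first last.
  - rewrite /field_ratio /= inE eqxx (negbTE uus) addn0 addn1 exprS.
    field; rewrite ?expf_neq0 ?gt_eqF//.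
  - by move=> w wu; rewrite /raise1 /= inE (negbTE wu).
  have Z1 := sub_sum_at_true_gt0 W k2 u.
  have Z0 := sub_sum_at_ge0 W k2 u false.
  rewrite /edge_map /spin_ratio; field.
  rewrite !gt_eqF//= ?andbT; by rewrite ltr_wpDl// mulr_gt0.
have -> : \prod_(w <- us) edge_map (spin_ratio W
    (if w == u then k2 else child_field us (raise0 [:: u] k) w) w) =
  \prod_(w <- us) edge_map (spin_ratio W (child_field us (raise0 [:: u] k) w) w).
  rewrite big_seq [RHS]big_seq; apply: eq_bigr => w wus.
  by case: eqP => // wu; move: uus; rewrite -wu wus.
ring.
Qed.

(* Weitz's self-avoiding walk recursion, one step at a time: no tree is built,
   the cut cycles are remembered in the fields of the neighbours. *)
Lemma spin_ratioE W k v : v \in W ->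
  spin_ratio W k v = field_ratio (k v) * \prod_(u <- nbrs W v)
    edge_map (spin_ratio (W :\ v) (child_field (nbrs W v) k u) u).
Proof.
move=> vW; rewrite {1}/spin_ratio !sub_sum_at_freeze//.
have adjE u : u \in W :\ v -> (u \in nbrs W v) = adj v u.
  by rewrite mem_enum !inE => /andP[_ ->].
have -> : sub_sum (W :\ v) (freeze [set v] [ffun=> false] k) =
  sub_sum (W :\ v) (raise0 (nbrs W v) k).
  by apply: eq_sub_sum => u uW; rewrite freeze1 /raise0 adjE.
have -> : sub_sum (W :\ v) (freeze [set v] [ffun=> true] k) =
  sub_sum (W :\ v) (raise1 (nbrs W v) k).
  by apply: eq_sub_sum => u uW; rewrite freeze1 /raise1 adjE.
rewrite spin_ratio_telescope ?enum_uniq//; last first.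
  move=> u; rewrite mem_enum !inE => /andP[-> vu]; rewrite andbT.
  by apply: contraTneq vu => ->; rewrite adj_irrefl.
have S0 : sub_sum (W :\ v) (raise1 (nbrs W v) k) != 0.
  by rewrite gt_eqF// (sub_sum_gt0 v).
rewrite cardE -/(nbrs W v); field; by rewrite S0 expf_neq0// gt_eqF.
Qed.

(** Since [beta] < [gamma^-1], every neighbour, lost or present, contributes at most [gamma^-1]. *)
Lemma spin_ratio_le W k v : v \in W ->
  spin_ratio W k v <= lambda * gamma ^- (lost (k v) + size (nbrs W v)).
Proof.
move=> vW; rewrite spin_ratioE// /lost -addnA exprD invfM mulrA exprD invfM [leRHS]mulrA.
have bg : beta <= gamma^-1.
  rewrite -[leRHS]mul1r ler_pdivlMr// ltW//; by case: af.
apply: ler_pM.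
- exact: field_ratio_ge0.
- rewrite prodr_ge0// => u _; rewrite ltW// edge_map_gt0// spin_ratio_ge0//.
- apply: ler_wpM2r; first by rewrite invr_ge0 exprn_ge0// ltW.
  apply: ler_wpM2l; first exact: ltW.
  by rewrite -exprVn lerXn2r// nnegrE ?invr_ge0// ltW.
- rewrite -exprVn.
  pose F u := edge_map (spin_ratio (W :\ v) (child_field (nbrs W v) k u) u).
  have F0 u : 0 <= F u by rewrite ltW// edge_map_gt0// spin_ratio_ge0.
  have F1 u : F u <= gamma^-1 by apply: edge_map_le; rewrite spin_ratio_ge0.
  rewrite -/(\prod_(u <- nbrs W v) F u); move: F F0 F1 => F F0 F1.
  elim: (nbrs W v) => [|u us IH] /=; first by rewrite big_nil expr0.
  by rewrite big_cons exprS ler_pM// prodr_ge0.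
Qed.

Lemma weightE s : weight beta gamma lambda s = sub_weight finset.setT no_field s.
Proof.
congr (_ * _); first by apply: eq_bigl => e; rewrite !inE !andbT.
apply: eq_big => [u|u _]; first by rewrite inE.
by rewrite /vertex_weight /field_ratio /= expr0 invr1 !mulr1.
Qed.

Lemma partition_function_gt0 v : 0 < partition_function beta gamma lambda G.
Proof.
have := sub_sum_gt0 v finset.setT no_field.
rewrite /sub_sum /partition_function; congr (_ < _).
apply: eq_big => [s|s _]; last by rewrite weightE.
by apply/forall_inP => u; rewrite !inE.
Qed.

(** The constant does not depend on [b], so it cancels in the marginal; feasibility of the boundary
    excludes that it is 0. *)
Lemma sum_weight_freeze L t v : v \notin L -> exists2 c, 0 <= c &
  forall b, \sum_(s : config G | (s v == b) && agree_on L t s) weight beta gamma lambda s =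
    c * sub_sum_at (~: L) (freeze L t no_field) v b.
Proof.
move=> vL.
exists (sub_weight L no_field t * \prod_(u in ~: L)
  gamma ^+ #|[set w in L | adj w u && t w]|).
  rewrite mulr_ge0 ?sub_weight_ge0// prodr_ge0// => u _.
  by rewrite exprn_ge0// ltW.
move=> b; rewrite /sub_sum_at mulr_sumr.
rewrite (eq_bigl (fun s : config G => agree_on L t s && (s v == b))); last first.
  by move=> s; rewrite andbC.
rewrite big_mkcondr [RHS]big_mkcondr /=.
pose F (s : config G) := if s v == b then
  sub_weight L no_field t *
    \prod_(u in ~: L) gamma ^+ #|[set w in L | adj w u && t w]| *
    sub_weight (~: L) (freeze L t no_field) s else 0.
rewrite -/(\sum_(s | agree_on _ _ s) F s).
rewrite (@sum_agree_indep (~: L) all_true t F); last first.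
  move=> s s' ss'; rewrite /F ss' ?inE//; case: eqP => // _.
  by congr (_ * _); apply: eq_sub_weight.
rewrite finset.setCK.
apply: eq_bigr => s /forall_inP h; rewrite /F; case: eqP => // _.
have tsL : {in L, s =1 t} by move=> u uL; apply/eqP/h.
rewrite weightE -(finset.setUCr L) sub_weight_split; last first.
  by rewrite -setI_eq0 finset.setICr.
rewrite (@eq_sub_weight _ _ no_field _ t)//.
congr (_ * _ * _).
  apply: eq_bigr => u _; congr (_ ^+ _); apply: eq_card => w.
  by rewrite !inE; case wL: (w \in L) => //=; rewrite tsL.
by apply: eq_sub_weight => // u _; apply: freeze_congr => w wL _; exact: tsL.
Qed.

Lemma marginalE L t v : v \notin L -> feasible beta gamma lambda L t ->
  let r := spin_ratio (~: L) (freeze L t no_field) v in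
  marginal beta gamma lambda v L t = r / (1 + r).
Proof.
move=> vL fe r.
have [c c0 hc] := sum_weight_freeze t vL.
have Z0 := partition_function_gt0 v.
have gp (A : pred (config G)) : gibbs_prob beta gamma lambda A =
  (\sum_(s | A s) weight beta gamma lambda s) / partition_function beta gamma lambda G.
  by rewrite /gibbs_prob mulr_suml.
have tot : \sum_(s | agree_on L t s) weight beta gamma lambda s =
   c * (sub_sum_at (~: L) (freeze L t no_field) v false +
        sub_sum_at (~: L) (freeze L t no_field) v true).
  rewrite mulrDr -!hc (bigID (fun s : config G => s v == false)) /=.
  congr (_ + _); apply: eq_bigl => s; rewrite andbC//.
  by case: (s v).
move: fe; rewrite /feasible /marginal !gp tot /= hc.
set Z := partition_function _ _ _ _ in Z0 *.
have := sub_sum_at_true_gt0 (~: L) (freeze L t no_field) v.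
have := sub_sum_at_ge0 (~: L) (freeze L t no_field) v false.
rewrite /r /spin_ratio; move: (sub_sum_at _ _ _ false) (sub_sum_at _ _ _ true).
move=> A B A0 B0 fe.
have cpos : 0 < c.
  rewrite lt_neqAle c0 andbT; apply: contraTneq fe => <-.
  by rewrite !mul0r ltxx.
have BA : 0 < B + A by rewrite ltr_wpDr.
field; by rewrite !gt_eqF.
Qed.

End Recursion.

(** * Decay of correlations along the recursion *)

Section Decay.
Variable Delta : option nat.

Definition rate d : R := slope d * expR (slope d - 1).

Lemma rate0 : rate 0 = 0.
Proof. by rewrite /rate /slope !mul0r. Qed.

Lemma rate_ge0 d : 0 <= rate d.
Proof. by rewrite mulr_ge0 ?expR_ge0// slope_ge0. Qed.

Section Graph.
Variable G : sgraph.
Implicit Types (W L : {set G}) (k : G -> nat * nat) (u v w : G).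

(** This is the number of children in the recursion at [u]; frozen neighbours still count. *)
Definition slots W k u := (lost (k u) + size (nbrs W u))%N.

Lemma tame_vertex W k k' v M : 0 <= M -> v \in W -> k v = k' v ->
  (forall u, u \in nbrs W v -> exists X, [/\ tame M X,
     X 0 = spin_ratio (W :\ v) (child_field (nbrs W v) k u) u &
     X 1 = spin_ratio (W :\ v) (child_field (nbrs W v) k' u) u]) ->
  exists X, [/\ tame (rate (slots W k v) * M) X,
    X 0 = spin_ratio W k v & X 1 = spin_ratio W k' v].
Proof.
move=> M0 vW kv H.
have /choice[X HX] : forall u, exists X : R -> R, u \in nbrs W v ->
   [/\ tame M X, X 0 = spin_ratio (W :\ v) (child_field (nbrs W v) k u) u &
     X 1 = spin_ratio (W :\ v) (child_field (nbrs W v) k' u) u].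
  move=> u; have [/H[X hX]|_] := boolP (u \in nbrs W v); first by exists X.
  by exists (fun=> 0).
exists (fun t => field_ratio (k v) *
  \prod_(u <- nbrs W v) edge_map (X u t)).
split; last 2 first.
- rewrite spin_ratioE//; congr (_ * _); rewrite big_seq [RHS]big_seq.
  by apply: eq_bigr => u /HX[_ -> _].
- rewrite spin_ratioE// -kv; congr (_ * _); rewrite big_seq [RHS]big_seq.
  by apply: eq_bigr => u /HX[_ _ ->].
have [d0|dpos] := posnP (slots W k v).
  have /size0nil-> : size (nbrs W v) = 0%N by move: d0; rewrite /slots; lia.
  under eq_fun do rewrite big_nil mulr1.
  apply: tame_const; last exact: field_ratio_ge0.
  by rewrite mulr_ge0 ?rate_ge0.
by apply: tame_step => // u /HX[].
Qed.

Lemma size_nbrs_remove W v w : v \in W ->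
  size (nbrs W w) = (size (nbrs (W :\ v) w) + adj v w)%N.
Proof.
move=> vW; rewrite -!cardE (cardsD1 v) !inE vW /= adj_sym addnC; congr (_ + _)%N.
by apply: eq_card => x; rewrite !inE andbA.
Qed.

(** The child [u] spends one slot on its parent [v]. Any other neighbour of [v] keeps its count, as
    its edge to [v] becomes a frozen one. *)
Lemma slots_child W k v u w : v \in W -> u \in nbrs W v -> w \in W :\ v ->
  (slots (W :\ v) (child_field (nbrs W v) k u) w + (w == u) = slots W k w)%N.
Proof.
move=> vW uN wW; rewrite /slots (size_nbrs_remove w vW).
have wN : (w \in nbrs W v) = adj v w.
  by move: wW; rewrite mem_enum !inE => /andP[_ ->].
have [->|wu] := eqVneq w u.
  rewrite child_field_self ?enum_uniq//.
  by move: uN; rewrite mem_enum !inE => /andP[_ ->]; lia.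
by rewrite lost_child_field ?enum_uniq// wN; lia.
Qed.

Variables (q m : R).
Hypothesis q0 : 0 <= q.
Hypothesis rate_q : forall d, (0 < d)%N -> deg_lt d Delta -> rate d <= q.
Hypothesis m_bound : forall d, deg_le d Delta -> lambda * gamma ^- d <= m.

Let K := 4 * m / gamma.

Lemma m_ge0 : 0 <= m.
Proof.
have /m_bound : deg_le 0 Delta by case: Delta.
by apply: le_trans; rewrite expr0 invr1 mulr1 ltW.
Qed.

Lemma K_ge0 : 0 <= K.
Proof. by rewrite mulr_ge0 ?invr_ge0 ?(ltW g0)// mulr_ge0// m_ge0. Qed.

(** Walks may use all of [G] and only their ends must lie in [W], so the condition survives the
    removal of vertices. *)
Definition agree_near n W k k' v := forall p, path (@adj G) v p ->
  (size p < n)%N -> last v p \in W -> k (last v p) = k' (last v p).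

Lemma agree_near_child n W k k' v u us : adj v u ->
  agree_near n.+1 W k k' v ->
  agree_near n (W :\ v) (child_field us k u) (child_field us k' u) u.
Proof.
move=> vu H p pp sp; rewrite inE => /andP[_ lW]; apply: child_field_congr.
by apply: (H (u :: p)) => //=; rewrite vu.
Qed.

Lemma slots_child_le W k v u : v \in W -> u \in nbrs W v ->
  (forall w, w \in W -> deg_le (slots W k w) Delta) ->
  forall w, w \in W :\ v ->
    deg_le (slots (W :\ v) (child_field (nbrs W v) k u) w) Delta.
Proof.
move=> vW uN H w wW; have := H w; rewrite -(slots_child k vW uN wW).
move: wW; rewrite inE => /andP[_ wW] /(_ wW).
by case: Delta => //= D; lia.
Qed.

(** The strict degree bound at [v] reflects the edge already spent on a parent; the other vertices
    satisfy the weak one. *)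
Definition interpolable n W v :=
  forall k k', (forall u, u \in W -> deg_le (slots W k u) Delta) ->
  (forall u, u \in W -> deg_le (slots W k' u) Delta) ->
  deg_lt (slots W k v) Delta -> agree_near n W k k' v ->
  exists X, [/\ tame (q ^+ n * K) X,
    X 0 = spin_ratio W k v & X 1 = spin_ratio W k' v].

Lemma tame_from_children n W k k' v : v \in W ->
  (forall u, u \in W :\ v -> interpolable n (W :\ v) u) ->
  (forall u, u \in W -> deg_le (slots W k u) Delta) ->
  (forall u, u \in W -> deg_le (slots W k' u) Delta) ->
  agree_near n.+1 W k k' v ->
  exists X, [/\ tame (rate (slots W k v) * (q ^+ n * K)) X,
    X 0 = spin_ratio W k v & X 1 = spin_ratio W k' v].
Proof.
move=> vW IH kW k'W near_v.
have kk' : k v = k' v by apply: (near_v [::]).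
have M0 : 0 <= q ^+ n * K by rewrite mulr_ge0 ?exprn_ge0// K_ge0.
apply: (tame_vertex M0 vW kk') => u uN.
have /andP[uW vu] : (u \in W) && adj v u by move: uN; rewrite mem_enum inE.
have uWv : u \in W :\ v.
  by rewrite !inE uW andbT; apply: contraTneq vu => ->; rewrite adj_irrefl.
apply: IH => //; try exact: slots_child_le.
  have := kW _ uW; rewrite -(slots_child k vW uN uWv) eqxx.
  by case: Delta => //= D; rewrite addn1.
exact: agree_near_child near_v.
Qed.

(** At [n] = 0 nothing is known about the fields and [tame_square] supplies the curve; each further
    level of agreement gains a factor [q]. *)
Lemma all_interpolable n W v : v \in W -> interpolable n W v.
Proof.
elim: n W v => [|n IH] W v vW k k' kW k'W kv near_v.
  rewrite expr0 mul1r; apply: tame_square; apply/andP; split;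
    rewrite ?spin_ratio_ge0//.
    by apply: le_trans (spin_ratio_le _ vW) _; apply: m_bound; exact: kW.
  by apply: le_trans (spin_ratio_le _ vW) _; apply: m_bound; exact: k'W.
have [X [tX X0 X1]] := tame_from_children vW (IH (W :\ v)) kW k'W near_v.
exists X; split=> //; apply: tame_le tX.
rewrite exprS -mulrA; apply: ler_wpM2r; first by rewrite mulr_ge0 ?exprn_ge0 ?K_ge0.
case: (posnP (slots W k v)) => [->|dpos]; first by rewrite rate0.
exact: rate_q.
Qed.

(* The root may have one child more than the other vertices, so its own step
   need not contract: it only costs the constant factor [S]. *)
Lemma tame_exists_root n W k k' v S : v \in W ->
  (forall u, u \in W -> deg_le (slots W k u) Delta) ->
  (forall u, u \in W -> deg_le (slots W k' u) Delta) ->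
  rate (slots W k v) <= S -> agree_near n.+1 W k k' v ->
  exists X, [/\ tame (S * (q ^+ n * K)) X,
    X 0 = spin_ratio W k v & X 1 = spin_ratio W k' v].
Proof.
move=> vW kW k'W kS near_v.
have [X [tX X0 X1]] := tame_from_children vW (@all_interpolable n _) kW k'W near_v.
exists X; split=> //; apply: tame_le tX.
by apply: ler_wpM2r => //; rewrite mulr_ge0 ?exprn_ge0// K_ge0.
Qed.

End Graph.

(** The probability x / (1 + x) has speed dx / (1 + x)^2, while x [quad x] is at most (1 + beta)(1 +
    gamma)(1 + x)^3; the mean value theorem concludes. *)
Lemma tame_prob M X : 0 <= M -> tame M X ->
  (X 0 / (1 + X 0) - X 1 / (1 + X 1)) ^+ 2 <= M * ((1 + beta) * (1 + gamma)).
Proof.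
move=> M0 tX.
have /choice[dX HdX] : forall t : R, exists dx : R, [/\ 0 <= X t, is_derive t 1 X dx &
    dx ^+ 2 <= M * (X t * quad (X t))].
  by move=> t; have [h [dx h1 h2]] := tX t; exists dx.
pose p t := X t / (1 + X t); pose dp t := dX t / (1 + X t) ^+ 2.
have hp (t : R) : is_derive t 1 p (dp t).
  have [X0 h _] := HdX t.
  have n1 : 1 + X t != 0 by rewrite gt_eqF// ltr_pwDl.
  have h1 : is_derive t 1 (fun t => (1 + X t)^-1) (- (1 + X t) ^- 2 * dX t).
    by apply: is_derive_eq; rewrite /GRing.scale /=; ring.
  apply: (is_derive_eq (is_deriveM h h1)); rewrite /GRing.scale /= /dp.
  by field.
have pcont : ({within `[0, 1], continuous p})%classic.
  apply: continuous_subspaceT => t.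
  by apply/differentiable_continuous/derivable1_diffP; have [] := hp t.
have [c _ hc] := MVT ltr01 (fun t _ => hp t) pcont.
have -> : (X 0 / (1 + X 0) - X 1 / (1 + X 1)) ^+ 2 = dp c ^+ 2.
  by rewrite -sqrrN opprB -/(p 1) -/(p 0) hc subr0 mulr1.
have [X0 _ dXc] := HdX c.
have n1 : 0 < 1 + X c by rewrite ltr_pwDl.
rewrite /dp expr_div_n -exprM ler_pdivrMr ?exprn_gt0//.
apply: le_trans dXc _; rewrite -mulrA ler_wpM2l//.
set x := X c in X0 n1 *.
have y1 : 1 <= 1 + x by rewrite lerDl.
have h1 : x <= 1 + x by rewrite lerDr.
have h2 : beta * x + 1 <= (1 + beta) * (1 + x) by have := b0; nra.
have h3 : x + gamma <= (1 + gamma) * (1 + x) by have := ltW g0; nra.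
have q1 : quad x <= (1 + beta) * (1 + x) * ((1 + gamma) * (1 + x)).
  by rewrite ler_pM// ?addr_ge0 ?mulr_ge0 ?(ltW g0).
have q2 : x * quad x <= (1 + x) * ((1 + beta) * (1 + x) * ((1 + gamma) * (1 + x))).
  by rewrite ler_pM// ltW// quad_gt0.
apply: le_trans q2 _.
rewrite (_ : _ * (_ * _) = (1 + beta) * (1 + gamma) * (1 + x) ^+ 3); last by ring.
rewrite ler_wpM2l ?mulr_ge0 ?addr_ge0 ?(ltW g0)//.
by rewrite ler_weXn2l.
Qed.

End Decay.

(** * Uniform bounds drawn from uniqueness *)

Section Uniqueness.

Local Notation xh := (tree_fixpoint beta gamma lambda).

Lemma tree_map_derive_slope d : (0 < d)%N ->
  `|derive1 (tree_map beta gamma lambda d) (xh d)| = slope d.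
Proof. by move=> d0; rewrite tree_map_derivE. Qed.

Lemma rate_le_slope d : slope d <= 1 -> rate d <= slope d.
Proof.
move=> s1; rewrite /rate ler_piMr ?slope_ge0//.
by rewrite -[leRHS]expR0 ler_expR subr_le0.
Qed.

(** If [gamma] <= 1, the fixed point lies between c / d and M for large d, with c and M independent
    of d, and the slope reaches 1. *)
Lemma slope_lt1_gamma : (forall d, (0 < d)%N -> slope d < 1) -> 1 < gamma.
Proof.
move=> H; rewrite ltNge; apply/negP => g1.
have b1 : 0 < 1 - beta.
  case: af => _ bg _ _ _; have := bg1; rewrite !subr_gt0 => bg'.
  rewrite lt_neqAle (le_trans bg g1) andbT; apply: contraTneq bg' => b1.
  have -> : gamma = 1 by apply/eqP; rewrite eq_le g1 -{1}b1.
  by rewrite b1 mulr1 ltxx.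
(* At [M] the base of the power in f_d is at most 1, so f_d(M) <= lambda <= M for every d. *)
pose M := Num.max ((1 - gamma) / (1 - beta)) lambda.
have Ml : lambda <= M by rewrite le_max lexx orbT.
have M0 : 0 <= M by apply: le_trans Ml; exact: ltW.
have Mx : 1 - gamma <= M * (1 - beta).
  by rewrite -ler_pdivrMr// le_max lexx.
(* With x <= M, the bound d x >= c makes the slope at least 1. *)
pose c := quad M / (1 - beta * gamma).
have qM : 0 < quad M by apply: quad_gt0.
have c0 : 0 < c by rewrite divr_gt0.
(* For such d, lambda exp(-c) >= c / d. As [edge_map e] >= exp(-e) when [gamma] <= 1, this gives
   f_d(e) >= e at e = c / d. *)
pose d := (Num.trunc (c * expR c / lambda)).+1.
have dgt : c * expR c / lambda < d%:R by exact: truncnS_gt.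
have d0 : 0 < d%:R :> R by rewrite ltr0n.
have [[x0 xE] _] := tree_fixpointP d af; set x := xh d in x0 xE.
have xM : x <= M.
  rewrite leNgt; apply/negP => Mlt.
  have := tree_map_le d af M0 (ltW Mlt); rewrite xE => h.
  suff : tree_map beta gamma lambda d M <= lambda by lra.
  rewrite /tree_map ler_piMr ?(ltW l0)// exprn_ile1//.
    by rewrite ltW// edge_map_gt0.
  by rewrite ler_pdivrMr ?ltr_wpDl//; lra.
have xc : c / d%:R <= x.
  rewrite leNgt; apply/negP => xlt.
  set e := c / d%:R in xlt.
  have e0 : 0 < e by rewrite divr_gt0.
  have := tree_map_le d af (ltW x0) (ltW xlt); rewrite xE => h.
  suff : e <= tree_map beta gamma lambda d e by lra.
  have h1 : expR (- e) <= (beta * e + 1) / (e + gamma).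
    rewrite expRN ler_pdivlMr ?ltr_wpDl ?(ltW e0)// ler_pdivrMl ?expR_gt0//.
    have h1 : 1 + e <= expR e by exact: expR_ge1Dx.
    have h2 : 0 <= beta * e by rewrite mulr_ge0// ltW.
    have h3 : 1 * (1 + e) <= (beta * e + 1) * expR e.
      by apply: ler_pM => //; lra.
    by rewrite mulrC; lra.
  have h2 : expR (- c) <= ((beta * e + 1) / (e + gamma)) ^+ d.
    have -> : - c = - e * d%:R by rewrite mulNr divfK// gt_eqF.
    by rewrite expRM_natr lerXn2r// nnegrE ?expR_ge0// (le_trans (expR_ge0 _) h1).
  apply: (@le_trans _ _ (lambda * expR (- c))); last first.
    by apply: ler_wpM2l => //; exact: ltW.
  rewrite expRN ler_pdivrMr// mulrAC ler_pdivlMr ?expR_gt0//.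
  by rewrite -ler_pdivrMl// mulrC ltW.
have := H d isT; apply/negP; rewrite -leNgt /slope -/x.
have qx : 0 < quad x by apply: quad_gt0; exact: ltW.
rewrite ler_pdivlMr// mul1r.
have q1 : quad x <= quad M.
  by rewrite ler_pM ?addr_ge0 ?mulr_ge0 ?(ltW g0) ?(ltW x0)// lerD2r// ler_wpM2l.
apply: (le_trans q1).
have -> : quad M = c * (1 - beta * gamma) by rewrite divfK// gt_eqF.
rewrite [leRHS]mulrAC; apply: ler_wpM2r; first exact: ltW.
by rewrite mulrC -ler_pdivrMr.
Qed.

(** The fixed point is at most [lambda * gamma ^- d], so d times it tends to 0. *)
Lemma slope_eventually_le : 1 < gamma ->
  exists N, forall d, (N <= d)%N -> slope d <= 1 / 2.
Proof.
move=> g1; pose a := ln gamma.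
have a0 : 0 < a by rewrite ln_gt0.
(* From gamma^d >= (a d / 2)^2 the fixed point is at most 4 lambda / (a d)^2; d > B then
   suffices. *)
pose B := 8 * lambda / (gamma * a ^+ 2).
exists (Num.trunc B).+1 => d dN.
have Bd : B < d%:R by apply: lt_le_trans (truncnS_gt B) _; rewrite ler_nat.
have d0 : 0 < d%:R :> R by rewrite ltr0n (leq_trans _ dN).
have [[x0 xE] _] := tree_fixpointP d af; rewrite /slope; set x := xh d in x0 xE *.
have qx : gamma <= quad x.
  rewrite -[leLHS]mul1r ler_pM ?(ltW g0)//.
    by rewrite lerDr mulr_ge0// ltW.
  by rewrite lerDr ltW.
have gd : (a * d%:R / 2) ^+ 2 <= gamma ^+ d.
  have -> : gamma ^+ d = expR (a * d%:R / 2) ^+ 2.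
    rewrite -expRM_natr -[in LHS](lnK (x := gamma)) ?posrE// -expRM_natr.
    by congr expR; rewrite -/a; field.
  rewrite lerXn2r ?nnegrE ?expR_ge0//.
    by rewrite divr_ge0// mulr_ge0// ltW.
  by apply: le_trans (expR_ge1Dx _); rewrite lerDr.
have xl : x <= lambda * gamma ^- d.
  rewrite -[leLHS]xE /tree_map -exprVn; apply: ler_wpM2l; first exact: ltW.
  apply: lerXn2r; rewrite ?nnegrE ?invr_ge0 ?(ltW g0)//.
    by rewrite ltW// edge_map_gt0// ltW.
  by apply: edge_map_le; exact: ltW.
have ad0 : 0 < (a * d%:R / 2) ^+ 2 by rewrite exprn_gt0// divr_gt0// mulr_gt0.
have xl2 : x <= lambda / (a * d%:R / 2) ^+ 2.
  apply: le_trans xl _; rewrite ler_wpM2l ?(ltW l0)// lef_pV2// posrE//.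
  by rewrite exprn_gt0.
rewrite ler_pdivrMr ?(lt_le_trans g0 qx)//.
apply: (@le_trans _ _ (1 / 2 * gamma)); last by rewrite ler_wpM2l//; lra.
apply: (@le_trans _ _ (d%:R * x)).
  by rewrite ler_wpM2r ?(ltW x0)// ler_piMr ?(ltW d0)// gerBl mulr_ge0// ltW.
apply: (@le_trans _ _ (d%:R * (lambda / (a * d%:R / 2) ^+ 2))).
  by rewrite ler_wpM2l// ltW.
have -> : d%:R * (lambda / (a * d%:R / 2) ^+ 2) = 4 * lambda / a ^+ 2 / d%:R.
  field; by rewrite !gt_eqF.
rewrite ler_pdivrMr//.
have -> : 4 * lambda / a ^+ 2 = 1 / 2 * gamma * B.
  rewrite /B; field; by rewrite !gt_eqF.
by rewrite ler_wpM2l ?(ltW Bd)// mulr_ge0// ?(ltW g0)//; lra.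
Qed.

Variable Delta : option nat.
Hypothesis uniq_Delta : Delta_unique beta gamma lambda Delta.

Lemma slope_lt1 d : (0 < d)%N -> deg_lt d Delta -> slope d < 1.
Proof. by move=> d0 dD; rewrite -tree_map_derive_slope//; exact: uniq_Delta. Qed.

Lemma gamma_gt1_infinite : Delta = None -> 1 < gamma.
Proof.
by move=> D; apply: slope_lt1_gamma => d d0; apply: slope_lt1; rewrite ?D.
Qed.

(** Strictness at each d becomes uniform: finitely many d below some N, and slope at most 1/2
    beyond. For finite [Delta] the second range is empty. *)
Lemma rate_bound : exists2 q, 0 < q < 1 &
  forall d, (0 < d)%N -> deg_lt d Delta -> rate d <= q.
Proof.
have [N HN] : exists N, forall d, (N <= d)%N -> deg_lt d Delta -> slope d <= 1 / 2.
  case: Delta uniq_Delta gamma_gt1_infinite => [D|] _ g1.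
    by exists D => d Dd /=; rewrite ltnNge Dd.
  have [N HN] := slope_eventually_le (g1 erefl).
  by exists N => d /HN.
have [|q /andP[q0 q1] Hq] := @initial_segment_bounded_lt1 R
  (fun d => if (0 < d)%N && deg_lt d Delta then slope d else 0) N.
  by move=> d _; case: ifP => // /andP[*]; exact: slope_lt1.
exists (Num.max q (1 / 2)).
  by rewrite lt_max q0 gt_max q1/=; lra.
move=> d d0 dD; apply: (@le_trans _ _ (slope d)).
  by apply: rate_le_slope; rewrite ltW// slope_lt1.
rewrite le_max; have [dN|Nd] := ltnP d N.
  by have := Hq d dN; rewrite d0 dD => ->.
by rewrite HN// orbT.
Qed.

(** For finite [Delta], d = Delta lies outside the range of uniqueness, so mere finiteness is
    claimed. *)
Lemma rate_bound_root : exists2 S, 0 <= S &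
  forall d, deg_le d Delta -> rate d <= S.
Proof.
case: Delta uniq_Delta rate_bound => [D|] _ hq.
  have [S S0 HS] := initial_segment_bounded rate D.+1.
  by exists S => // d dD; apply: HS.
have [q /andP[q0 q1] Hq] := hq; exists q; first exact: ltW.
by case=> [|d] _; [rewrite rate0 ltW|exact: Hq].
Qed.

Lemma field_bound : exists m, forall d, deg_le d Delta -> lambda * gamma ^- d <= m.
Proof.
case: Delta uniq_Delta gamma_gt1_infinite => [D|] _ g1.
  have [S _ HS] := initial_segment_bounded (fun d => lambda * gamma ^- d) D.+1.
  by exists S => d dD; apply: HS.
exists lambda => d _; rewrite ler_piMr ?(ltW l0)// -exprVn exprn_ile1//.
  by rewrite invr_ge0 ltW.
by rewrite invf_le1// ltW// g1.
Qed.

End Uniqueness.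

(** * Marginals under boundary conditions; uniqueness implies mixing *)

Section Graph.
Variable G : sgraph.
Implicit Types (L : {set G}) (s t : config G) (u v w : G).

Lemma gibbs_ge0 s : 0 <= gibbs beta gamma lambda s.
Proof.
have w0 s' : 0 <= weight beta gamma lambda s' by rewrite weightE sub_weight_ge0.
by rewrite divr_ge0// sumr_ge0.
Qed.

Lemma marginal_ge0_le1 v L t : feasible beta gamma lambda L t ->
  0 <= marginal beta gamma lambda v L t <= 1.
Proof.
move=> fe; apply/andP; split.
  by rewrite divr_ge0 ?(ltW fe)// sumr_ge0// => s _; exact: gibbs_ge0.
rewrite ler_pdivrMr// mul1r /gibbs_prob [leRHS](bigID (fun s : config G => s v == false)) /=.
rewrite [leLHS](eq_bigl (fun s : config G => agree_on L t s && (s v == false))).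
  by rewrite lerDl sumr_ge0// => s _; exact: gibbs_ge0.
by move=> s; rewrite /= andbC.
Qed.

Lemma marginal_pinned v L t : v \in L -> feasible beta gamma lambda L t ->
  marginal beta gamma lambda v L t = (~~ t v)%:R.
Proof.
move=> vL fe; rewrite /marginal.
have E : gibbs_prob beta gamma lambda
    [pred s : config G | (s v == false) && agree_on L t s] =
    (~~ t v)%:R * gibbs_prob beta gamma lambda (agree_on L t).
  rewrite /gibbs_prob; case tv: (t v); last first.
    rewrite mul1r; apply: eq_bigl => s /=; case h: (agree_on L t s).
      by have /forall_inP/(_ v vL)/eqP -> := h; rewrite tv.
    by rewrite andbF.
  rewrite mul0r big_pred0// => s /=; case h: (agree_on L t s).
    by have /forall_inP/(_ v vL)/eqP -> := h; rewrite tv.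
  by rewrite andbF.
by rewrite E mulfK// gt_eqF.
Qed.

(** Neighbours in [L] are counted by the field, split by spin, and the others by [nbrs]. *)
Lemma slots_freeze L t u : u \notin L ->
  slots (~: L) (freeze L t no_field) u = #|adj u|.
Proof.
move=> uL; rewrite /slots /lost /freeze /= -cardE !add0n.
have -> : #|adj u| = #|[set w | adj u w]| by apply: eq_card => w; rewrite inE.
rewrite -(cardsID L [set w | adj u w]).
rewrite -(cardsID [set w | t w] ([set w | adj u w] :&: L)).
rewrite [X in _ = (X + _)%N]addnC; congr (_ + _ + _)%N; apply: eq_card => w;
  rewrite !inE ?(adj_sym w u); by case: (w \in L); case: (adj u w); case: (t w).
Qed.

End Graph.

Lemma strong_spatial_mixing_of_unique Delta : Delta_unique beta gamma lambda Delta ->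
  strong_spatial_mixing beta gamma lambda (max_degree_le Delta).
Proof.
move=> uD.
have [q /andP[q0 q1] Hq] := rate_bound uD.
have [S S0 HS] := rate_bound_root uD.
have [m Hm] := field_bound uD.
pose K := 4 * m / gamma; pose B := S * K * ((1 + beta) * (1 + gamma)).
have K0 : 0 <= K by exact: (K_ge0 Hm).
have B0 : 0 <= B.
  by rewrite mulr_ge0 ?(mulr_ge0 S0 K0)// mulr_ge0 ?addr_ge0 ?(ltW g0).
(* [tame] bounds the squared speed, so the rate per level is the square root of [q]. *)
pose A := Num.sqrt B; pose c := - ln q / 2.
have c0 : 0 < c by rewrite divr_gt0// oppr_gt0 ln_lt0// q0.
have A0 : 0 <= A by exact: sqrtr_ge0.
have qE n : q ^+ n = expR (- (c * n%:R)) ^+ 2.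
  rewrite -[in LHS](lnK (x := q)) ?posrE// -expRM_natr -expRM_natr /c.
  by congr expR; field.
(* Two levels are lost: one at the root, one because a disagreement acts through the field of a free
   neighbour. The summand 1 covers distances below 2. *)
exists ((1 + A) * expR (2 * c)), c; split=> //.
  by rewrite mulr_gt0 ?expR_gt0// ltr_pwDl.
move=> G HG v L sL tL fs ft; set D := disagreement L sL tL.
set x := `| _ |.
have C0 : 0 <= (1 + A) * expR (2 * c) by rewrite mulr_ge0 ?expR_ge0// addr_ge0.
have main N : (forall p, path (@adj G) v p -> last v p \in D -> (N <= size p)%N) ->
    x <= (1 + A) * expR (2 * c) * expR (- (c * N%:R)).
  move=> HN.
  have trivial : (N < 2)%N -> x <= (1 + A) * expR (2 * c) * expR (- (c * N%:R)).
    move=> N2; apply: (@le_trans _ _ 1).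
      have /andP[] := marginal_ge0_le1 v fs; have /andP[] := marginal_ge0_le1 v ft.
      by rewrite /x ler_norml => *; apply/andP; split; lra.
    rewrite -mulrA -expRD -[leLHS]mulr1 ler_pM// ?lerDl//.
    rewrite -[leLHS]expR0 ler_expR subr_ge0 mulrC; apply: ler_wpM2r; first exact: ltW.
    by rewrite (ler_nat R N 2) ltnW.
  have [N2|] := ltnP N 2; first exact: trivial.
  case: N HN {trivial} => [//|[//|n]] HN _.
  have [vL|vL] := boolP (v \in L).
    have stv : sL v = tL v.
      apply/eqP; apply: contraT => stv.
      by have := HN [::] isT; rewrite /= inE vL stv => /(_ isT).
    by rewrite /x !marginal_pinned// stv subrr normr0 mulr_ge0// expR_ge0.
  have vW : v \in ~: L by rewrite inE.
  have slotsP t u : u \in ~: L -> deg_le (slots (~: L) (freeze L t no_field) u) Delta.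
    by rewrite inE => uL; rewrite slots_freeze//; exact: HG.
  (* Fields differing at distance at most n would reveal a disagreement at distance at most n +
     1. *)
  have near_v : agree_near n.+1 (~: L) (freeze L sL no_field) (freeze L tL no_field) v.
    move=> p pp sp lW; apply: freeze_congr => w wL wu.
    apply/eqP; apply: contraT => stw.
    have := HN (rcons p w); rewrite rcons_path pp last_rcons size_rcons adj_sym wu.
    by rewrite inE wL stw => /(_ isT isT); rewrite ltnS leqNgt sp.
  have [X [tX X0 X1]] := tame_exists_root (ltW q0) Hq Hm vW (slotsP sL)
    (slotsP tL) (HS _ (slotsP sL v vW)) near_v.
  have M0 : 0 <= S * (q ^+ n * K) by rewrite mulr_ge0// mulr_ge0// exprn_ge0// ltW.
  have := tame_prob M0 tX; rewrite X0 X1 -!(marginalE vL)// => hx.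
  have x2 : x ^+ 2 <= (A * expR (- (c * n%:R))) ^+ 2.
    rewrite /x real_normK ?num_real// (le_trans hx)// exprMn -qE sqr_sqrtr//.
    by rewrite /B -/K le_eqVlt; apply/orP; left; apply/eqP; ring.
  have {}x2 : x <= A * expR (- (c * n%:R)).
    by move: x2; rewrite ler_sqr// nnegrE ?mulr_ge0 ?expR_ge0 ?normr_ge0.
  apply: (le_trans x2); rewrite -mulrA -expRD.
  have -> : 2 * c + - (c * n.+2%:R) = - (c * n%:R).
    by rewrite -[n.+2]addn2 natrD; ring.
  by rewrite ler_wpM2r ?expR_ge0// lerDr.
(* The distance is the least length of a walk to [D]. Without any walk, [main] applies for every N
   and the difference is 0. *)
pose P n := `[< exists p, [/\ path (@adj G) v p, last v p \in D & size p = n] >].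
have [exP|nexP] := pselect (exists n, P n).
  case: (ex_minnP exP) => N /asboolP[p [pp lp sp]] minN.
  have hN : x <= (1 + A) * expR (2 * c) * expR (- (c * N%:R)).
    by apply: main => p' pp' lp'; apply: minN; apply/asboolP; exists p'.
  apply: (@le_trans _ _ ((1 + A) * expR (2 * c) * expR (- (c * N%:R)))%:E).
    by rewrite lee_fin.
  rewrite EFinM lee_wpmul2l ?lee_fin//.
  have -> : (expR (- (c * N%:R)))%:E = expeR (- (c%:E * N%:R%:E)) by [].
  rewrite lee_expeR leeN2 lee_wpmul2l ?lee_fin ?(ltW c0)//.
  by apply: ereal_inf_lbound; exists p => //; rewrite sp.
have x0 : x <= 0.
  apply: (le_geometric_le0 c0 (C := (1 + A) * expR (2 * c))) => N; apply: main.
  move=> p pp lp; exfalso; apply: nexP; exists (size p).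
  by apply/asboolP; exists p.
apply: (@le_trans _ _ 0%E); first by rewrite lee_fin.
by rewrite mule_ge0 ?lee_fin// expeR_ge0.
Qed.

(** * Root ratios on the [d]-ary tree with constant leaves *)

Section TreeRatio.
Variables (d n : nat) (b : bool).

Local Notation T := (tree d n).
Local Notation leaves := (tree_leaves d n).
Definition boundary_field : nat * nat := if b then (0%N, d) else (d, 0%N).

Let k0 : T -> nat * nat := freeze leaves [ffun=> b] no_field.

Lemma tree_field (w : T) : (size (bseqval w) <= n)%N ->
  k0 w = if size (bseqval w) == n then boundary_field else (0%N, 0%N).
Proof.
move=> wn; rewrite /k0 /freeze /= !add0n.
have [wE|wn'] := eqVneq (size (bseqval w)) n.
  have E (p : bool) : #|[set z in leaves | adj z w && (p == b)]| = if p == b then d else 0%N.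
    case: (p == b); last first.
      by apply: eq_card0 => z; rewrite !inE !andbF.
    rewrite -[RHS](card_tree_children wn); apply: eq_card => z; rewrite !inE andbT.
    apply/andP/idP => [[/eqP zn /orP[/tree_child_size h|//]]|h].
      by move: wE; rewrite h zn => /eqP; rewrite eqn_leq leqNgt ltnS leqW.
    by split; [rewrite (tree_child_size h) wE|apply/orP; right].
  rewrite /boundary_field; case: b E => E.
    congr (_, _); last by rewrite -[RHS](E true); apply: eq_card => z; rewrite !inE ffunE.
    by rewrite -[RHS](E false); apply: eq_card => z; rewrite !inE ffunE.
  congr (_, _); last by rewrite -[RHS](E true); apply: eq_card => z; rewrite !inE ffunE.
  by rewrite -[RHS](E false); apply: eq_card => z; rewrite !inE ffunE.
have wlt : (size (bseqval w) < n)%N by rewrite ltn_neqAle wn' wn.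
have far (z : T) : z \in leaves -> tree_adj z w = false.
  rewrite inE => /eqP zn; apply/negP => zw.
  have wz : @adj T w z by rewrite /= tree_adj_sym.
  by have := tree_adj_size wz; rewrite zn ltnS leqNgt wlt.
by congr (_, _); apply: eq_card0 => z; rewrite [LHS]inE;
  have [zL|//] := boolP (z \in leaves); rewrite far.
Qed.

(** Induction on the height [j] above the lowest free level. Fields are prescribed only at
    descendants of [v], because [child_field] alters those of siblings. *)
Lemma tree_ratio j (W : {set T}) k (v : T) :
  (size (bseqval v) + j)%N = n -> v \in W ->
  (forall w : T, w \in W -> (size (bseqval w) <= n)%N) ->
  (forall w : T, w \in W -> adj v w -> tree_child v w) ->
  (forall w : T, suffix (bseqval v) (bseqval w) -> (size (bseqval w) <= n)%N ->
     w \in W /\ k w = k0 w) ->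
  spin_ratio W k v =
  iter j (tree_map beta gamma lambda d) (field_ratio boundary_field).
Proof.
elim: j W k v => [|j IH] W k v vn vW Wn Wv Wk.
  rewrite addn0 in vn; rewrite spin_ratioE//.
  have -> : nbrs W v = [::].
    apply/size0nil; rewrite -cardE; apply: eq_card0 => w; rewrite !inE.
    apply/negP => /andP[wW vw]; have := Wn _ wW.
    by rewrite (tree_child_size (Wv _ wW vw)) vn ltnn.
  have [_ ->] := Wk v (suffix_refl _) (Wn _ vW).
  by rewrite big_nil mulr1 tree_field ?vn ?eqxx.
have vlt : (size (bseqval v) < n)%N.
  by have := leq_addr j (size (bseqval v)).+1; rewrite addSnnS vn.
have nbrsE (w : T) : (w \in nbrs W v) = tree_child v w.
  rewrite mem_enum inE; apply/andP/idP => [[]|vw]; first exact: Wv.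
  have [wW _] : w \in W /\ k w = k0 w.
    apply: Wk; last by rewrite (tree_child_size vw).
    by have /tree_childP[i ->] := vw; exact: suffix_cons.
  by split => //; apply/orP; left.
have sz : size (nbrs W v) = d.
  rewrite -[RHS](card_tree_children (ltnW vlt)) -cardE; apply: eq_card => w.
  by rewrite -mem_enum nbrsE inE.
rewrite spin_ratioE// big_seq (eq_bigr (fun=> edge_map
  (iter j (tree_map beta gamma lambda d)
    (field_ratio boundary_field)))).
  rewrite -big_seq big_const_seq count_predT sz iter_mulr_1.
  have [_ ->] := Wk v (suffix_refl _) (ltnW vlt).
  rewrite tree_field ?(ltnW vlt)// ltn_eqF// /field_ratio /= expr0 invr1 !mulr1.
  by [].
move=> u; rewrite nbrsE => vu; congr edge_map.
have usz := tree_child_size vu; have /tree_childP[i uE] := vu.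
have sufvu : suffix (bseqval v) (bseqval u) by rewrite uE suffix_cons.
apply: IH.
- by rewrite usz addSnnS.
- have [uW _] : u \in W /\ k u = k0 u by apply: Wk; rewrite ?usz.
  by rewrite !inE uW andbT; apply/eqP => uv; move: usz; rewrite uv => /n_Sn.
- by move=> w; rewrite inE => /andP[_ /Wn].
- move=> w; rewrite !inE => /andP[wv wW] /orP[//|/tree_childP[i' uE']].
  by move: uE'; rewrite uE => -[_ /val_inj vw]; rewrite vw eqxx in wv.
move=> w uw wn; have [wW kw] := Wk w (suffix_trans sufvu uw) wn.
have wv : w != v.
  apply: contraTneq uw => ->; apply/negP => /size_suffix.
  by rewrite usz ltnn.
rewrite !inE wv wW; split=> //; rewrite -kw.
have [->|wu] := eqVneq w u; first by rewrite child_field_self ?enum_uniq.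
(* A proper descendant of [u] is too deep to be a child of [v], so its field is unchanged. *)
apply: child_field_notin; rewrite nbrsE; apply: contra wu => vw.
have /suffixP[s wE] := uw.
have s0 : size s = 0%N.
  apply/eqP; rewrite -(eqn_add2r (size (bseqval u))) add0n -size_cat -wE.
  by rewrite (tree_child_size vw) usz.
by apply/eqP/val_inj; rewrite /= wE (size0nil s0).
Qed.

Lemma tree_root_ratio :
  spin_ratio (~: leaves) k0 (tree_root d n) =
  iter n (tree_map beta gamma lambda d) (field_ratio boundary_field).
Proof.
have inW (w : T) : (w \in ~: leaves) = (size (bseqval w) <= n)%N.
  by rewrite !inE -ltnS ltn_neqAle size_bseq andbT.
apply: tree_ratio => [|||w|w _].
- by rewrite tree_rootE.
- by rewrite inW tree_rootE.
- by move=> w; rewrite inW.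
- by move=> _ /orP[//|/tree_childP[i]]; rewrite tree_rootE.
- by rewrite inW.
Qed.

(** Spin 1 on all inner vertices works: leaves are never adjacent, so no edge has two ends of spin
    0, even if [beta] = 0. *)
Lemma tree_feasible : feasible beta gamma lambda leaves [ffun=> b].
Proof.
pose s : config T := [ffun u : T => if u \in leaves then b else true].
have sw : 0 < weight beta gamma lambda s.
  apply: mulr_gt0; apply: prodr_gt0.
    move=> [x y] /andP[/= xy _]; rewrite !ffunE !inE.
    case: (eqVneq (size (bseqval x)) n.+1) => xn; last first.
      by case: ifP; case: b => //=.
    case: (eqVneq (size (bseqval y)) n.+1) => yn; last by case: b.
    move: xy => /orP[] /tree_child_size; rewrite xn yn => /eqP.
      by rewrite eqn_leq ltnn andbF.
    by rewrite eqn_leq ltnn andbF.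
  by move=> u _; rewrite /vertex_weight; case: ifP.
rewrite /feasible /gibbs_prob (bigD1 s)/=; last first.
  by apply/forall_inP => u uL; rewrite !ffunE uL.
rewrite ltr_wpDr ?sumr_ge0// => [s' _|]; first exact: gibbs_ge0.
by rewrite divr_gt0// (partition_function_gt0 (tree_root d n)).
Qed.

End TreeRatio.

(** * Orbits of f_d around its fixed point *)

Section FixedPoint.

Variable d : nat.
Hypothesis d0 : (0 < d)%N.
Local Notation f := (tree_map beta gamma lambda d).
Local Notation xh := (tree_fixpoint beta gamma lambda d).

Lemma tree_map_ge0 x : 0 <= x -> 0 <= f x.
Proof.
move=> x0; rewrite /tree_map mulr_ge0 ?(ltW l0)// exprn_ge0//.
by rewrite ltW// edge_map_gt0.
Qed.

Lemma tree_map_le_field x : 0 <= x -> f x <= lambda * gamma ^- d.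
Proof.
move=> x0; rewrite /tree_map -exprVn; apply: ler_wpM2l; first exact: ltW.
apply: lerXn2r; rewrite ?nnegrE ?invr_ge0 ?(ltW g0)//.
  by rewrite ltW// edge_map_gt0.
exact: edge_map_le.
Qed.

(** Keeps an orbit that starts off the fixed point from ever reaching it. *)
Lemma tree_map_inj x y : 0 <= x -> 0 <= y -> f x = f y -> x = y.
Proof.
move=> x0 y0 /(mulfI (lt0r_neq0 l0)) /eqP.
rewrite eqrXn2// ?(ltW (edge_map_gt0 _))// => /eqP.
have xg : x + gamma != 0 by rewrite gt_eqF// ltr_wpDl.
have yg : y + gamma != 0 by rewrite gt_eqF// ltr_wpDl.
move=> /eqP; rewrite eqr_div// => /eqP h.
have : (1 - beta * gamma) * (x - y) = 0 by lra.
by move/eqP; rewrite mulf_eq0 gt_eqF//= subr_eq0 => /eqP.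
Qed.

Lemma iter_tree_map_ge0 m x : 0 <= x -> 0 <= iter m f x.
Proof. by move=> x0; elim: m => //= m; exact: tree_map_ge0. Qed.

(** As f_d is decreasing, the two orbits exchange sides at each step and keep the fixed point
    between them. *)
Lemma fixpoint_between m x y : 0 <= x -> x <= xh <= y ->
  iter m f x <= xh <= iter m f y \/ iter m f y <= xh <= iter m f x.
Proof.
move=> x0 /andP[xx xy]; have [[h0 hE] _] := tree_fixpointP d af.
have y0 : 0 <= y by apply: le_trans xy; exact: ltW.
have mono u v : 0 <= u -> u <= xh <= v -> f v <= xh <= f u.
  move=> u0 /andP[ux xv]; apply/andP; split.
    by rewrite -[leRHS]hE tree_map_le// ltW.
  by rewrite -[leLHS]hE tree_map_le.
elim: m => [|m IH] /=; first by left; rewrite xx xy.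
by case: IH => h; [right|left]; apply: mono => //; exact: iter_tree_map_ge0.
Qed.

(** At slope exactly 1 distances may still shrink, hence a factor [rho] below 1; it follows from the
    difference quotient at the fixed point. *)
Lemma tree_map_expands rho : 0 < rho < 1 -> 1 <= slope d ->
  exists2 e, 0 < e & forall y, `|y - xh| < e -> rho * `|y - xh| <= `|f y - xh|.
Proof.
move=> /andP[rho0 rho1] s1.
have [[h0 hE] _] := tree_fixpointP d af.
have xg : xh + gamma != 0 by rewrite gt_eqF// addr_gt0.
have D := is_derive_tree_map beta lambda d xg.
have Df : `|'D_1 f xh| = slope d.
  by rewrite -derive1E tree_map_derive_slope.
have /cvg_ex[l] : derivable f xh 1 by case: D.
move=> Dl; have lE : 'D_1 f xh = l by apply: cvg_lim Dl; exact: Rhausdorff.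
have /cvgrPdist_lt := Dl => /(_ (1 - rho)); rewrite subr_gt0 rho1 => /(_ isT).
move=> /nbhs_ballP[e /= e0 He]; exists e => // y ye.
have [->|yx] := eqVneq y xh; first by rewrite subrr normr0 mulr0 normr_ge0.
have yb : ball 0 e (y - xh) by rewrite -ball_normE /ball_ /= sub0r normrN.
have yxn0 : y - xh != 0 by rewrite subr_eq0.
have := He _ yb yxn0; rewrite /GRing.scale /= mulr1 subrK hE => h.
have yx0 : 0 < `|y - xh| by rewrite normr_gt0 subr_eq0.
have l1 : 1 <= `|l| by rewrite -lE Df.
rewrite -ler_pdivlMr//.
have -> : `|f y - xh| / `|y - xh| = `|(y - xh)^-1 * (f y - xh)|.
  by rewrite normrM normfV mulrC.
have := ler_dist_dist l ((y - xh)^-1 * (f y - xh)) => h2.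
have := ler_norm (`|l| - `|(y - xh)^-1 * (f y - xh)|).
by lra.
Qed.

Lemma no_exponential_convergence x y C c : 0 <= x -> x <= xh < y ->
  0 < c -> 1 <= slope d ->
  ~ (forall m, `|iter m f x - iter m f y| <= C * expR (- (c * m%:R))).
Proof.
move=> x0 /andP[xx xy] c0 s1 H.
have [[h0 hE] _] := tree_fixpointP d af.
have y0 : 0 <= y by apply: ltW; apply: lt_trans xy.
pose e m := `|iter m f y - xh|.
have eH m : e m <= C * expR (- (c * m%:R)).
  apply: le_trans (H m).
  have xxy : x <= xh <= y by rewrite xx ltW.
  rewrite /e; have [/andP[h1 h2]|/andP[h1 h2]] := fixpoint_between m x0 xxy.
    by rewrite ger0_norm ?subr_ge0// ler0_norm ?subr_le0 ?(le_trans h1)//; lra.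
  by rewrite ler0_norm ?subr_le0// ger0_norm ?subr_ge0 ?(le_trans h1)//; lra.
have epos m : 0 < e m.
  rewrite normr_gt0 subr_eq0; elim: m => [|m IH] /=; first by rewrite gt_eqF.
  apply: contra_neq IH; rewrite -{1}hE => /tree_map_inj; apply; last exact: ltW.
  exact: iter_tree_map_ge0.
(* With half the assumed exponent, the lower bound [rho ^+ j] decays more slowly than the upper
   bound exp(-c j). *)
pose rho := expR (- (c / 2)).
have rho01 : 0 < rho < 1.
  by rewrite expR_gt0 -[ltRHS]expR0 ltr_expR oppr_lt0 divr_gt0.
have [del del0 Hdel] := tree_map_expands rho01 s1.
have C0 : 0 < C.
  have := lt_le_trans (epos 0%N) (eH 0%N).
  by rewrite mulr0 oppr0 expR0 mulr1.
have [M HM] : exists M : nat, C * expR (- (c * M%:R)) < del.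
  apply: contrapT => /forallNP h.
  have := @le_geometric_le0 R del C c c0; rewrite leNgt del0 => /(_ _)/negP; apply => //.
  by move=> N; rewrite leNgt; apply/negP/h.
have step j : e (M + j)%N < del.
  apply: le_lt_trans (eH _) _; apply: le_lt_trans HM.
  apply: ler_wpM2l; first exact: ltW.
  by rewrite ler_expR lerN2 ler_wpM2l ?(ltW c0)// ler_nat leq_addr.
have low j : rho ^+ j * e M <= e (M + j)%N.
  elim: j => [|j IH]; first by rewrite expr0 mul1r addn0.
  rewrite exprS addnS -mulrA; apply: le_trans (Hdel _ (step j)).
  by apply: ler_wpM2l => //; case/andP: rho01 => /ltW.
have c20 : 0 < c / 2 by rewrite divr_gt0.
(* Comparing the two bounds leaves e M below a constant times exp(-c j / 2) for all j. *)
have := @le_geometric_le0 R (e M) (C * expR (- (c * M%:R))) (c / 2) c20.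
rewrite leNgt epos => /(_ _)/negP; apply => // j.
have := le_trans (low j) (eH _).
rewrite -ler_pdivlMl ?exprn_gt0 ?expR_gt0// => h; apply: le_trans h _.
rewrite /rho -expRM_natr -expRN mulrCA -expRD -mulrA -expRD natrD.
rewrite le_eqVlt; apply/orP; left; apply/eqP; congr (_ * expR _); by field.
Qed.

End FixedPoint.

(** * Mixing implies uniqueness *)

Lemma unique_of_strong_spatial_mixing Delta :
  strong_spatial_mixing beta gamma lambda (max_degree_le Delta) ->
  Delta_unique beta gamma lambda Delta.
Proof.
move=> [C [c [C0 c0 ssm]]] d d0 dD.
rewrite tree_map_derive_slope// ltNge; apply/negP => s1.
pose f := tree_map beta gamma lambda d.
(* The values of f_d at 0 and at +oo: the ratios just above leaves of spin 1 and of spin 0. *)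
pose b := lambda * gamma ^- d; pose a := lambda * beta ^+ d.
have [[h0 hE] _] := tree_fixpointP d af; set xh := tree_fixpoint _ _ _ _ in h0 hE.
have bgV : beta <= gamma^-1.
  by rewrite -[leRHS]mul1r ler_pdivlMr// -subr_ge0 ltW.
have a0 : 0 <= a by rewrite mulr_ge0 ?exprn_ge0// ltW.
have ab : a <= b.
  rewrite /a /b -exprVn; apply: ler_wpM2l; first exact: ltW.
  by apply: lerXn2r => //; rewrite nnegrE invr_ge0 ltW.
have ax : a <= xh.
  rewrite -[leRHS]hE /tree_map; apply: ler_wpM2l; first exact: ltW.
  apply: lerXn2r; rewrite ?nnegrE//; first by rewrite ltW// edge_map_gt0// ltW.
  rewrite ler_pdivlMr ?addr_gt0//; have := bg1; lra.
have xb : xh < b.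
  rewrite -[ltLHS]hE /tree_map /b -exprVn ltr_pM2l//.
  rewrite ltrXn2r -?lt0n//.
  - by rewrite ltW// edge_map_gt0// ltW.
  - by rewrite ltr_pdivrMr ?addr_gt0// ltr_pdivlMl//;
    have := mulr_gt0 bg1 h0; lra.
have b0' : 0 <= b by exact: le_trans ab.
have iterb m x : 0 <= x <= b -> 0 <= iter m f x <= b.
  move=> xb'; elim: m => //= m /andP[h1 _].
  by rewrite tree_map_ge0//= tree_map_le_field.
have axb : a <= xh < b by rewrite ax.
(* The factor (1 + b)^2 passes from marginals to ratios; exp(-c) arises because the leaves of
   [tree d m] have depth m + 1. *)
apply: (no_exponential_convergence d0 a0 axb c0 s1
  (C := (1 + b) ^+ 2 * (C * expR (- c)))) => m.
have ia : 0 <= iter m f a <= b by apply: iterb; rewrite a0.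
have ib : 0 <= iter m f b <= b by apply: iterb; rewrite b0' lexx.
apply: le_trans (prob_dist_le ia ib) _.
rewrite -[leRHS]mulrA; apply: ler_wpM2l; first exact: sqr_ge0.
have deg : max_degree_le Delta (tree d m).
  move=> v; have := tree_degree v; move: dD; rewrite /deg_lt /deg_le.
  by case: (Delta) => // D dltD /leq_trans; apply.
have := ssm _ deg (tree_root d m) (tree_leaves d m) [ffun=> false] [ffun=> true]
  (tree_feasible d m false) (tree_feasible d m true).
have rootL : tree_root d m \notin tree_leaves d m by rewrite inE tree_rootE.
rewrite !(marginalE rootL); [|exact: tree_feasible|exact: tree_feasible].
rewrite !tree_root_ratio /boundary_field /field_ratio /= !expr0 invr1 !mulr1.
rewrite -/a -/b -/f => h.
rewrite -lee_fin; apply: (le_trans h); rewrite -mulrA EFinM.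
apply: lee_wpmul2l; first by rewrite lee_fin ltW.
rewrite -expRD.
have -> : (expR (- c + - (c * m%:R)))%:E = expeR (- (c%:E * m.+1%:R%:E)) :> \bar R.
  by rewrite -EFinM -EFinN /=; congr (expR _)%:E; rewrite -natr1; ring.
rewrite lee_expeR leeN2; apply: lee_wpmul2l; first by rewrite lee_fin ltW.
apply: le_ereal_inf_tmp => _ [p /= [pp lp] <-].
rewrite lee_fin ler_nat; have := tree_path_size pp.
move: lp; rewrite tree_rootE inE => /andP[].
by rewrite inE => /eqP -> _.
Qed.

End SpinSystem.

Theorem theorem1 (R : realType) (beta gamma lambda : R) (Delta : option nat)
    (hparam : antiferromagnetic beta gamma lambda)
    (hDelta : deg_le 2 Delta) :
  strong_spatial_mixing beta gamma lambda (max_degree_le Delta) <->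
  Delta_unique beta gamma lambda Delta.
Proof.
split; first exact: unique_of_strong_spatial_mixing.
exact: strong_spatial_mixing_of_unique.
Qed.
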